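(* Let $a,A,b,B\in\mathbb{C}\setminus\{0\}$. For $n=\pm(2m+1)$, $m\to\infty$, we have $$\beta_n^+(z)=\sigma_0^+(n,0)\left[1+O\left(\frac{\log m}{m}\right)\right]\quad\text{if } z=O(1/m)$$ and $$\beta_n^+(z_n^\pm)=\sigma_0^+(n,0)\left[1+O\left(\frac{\log^2m}{m^2}\right)\right],$$ with $$\sigma_0^+(n,0)=\begin{cases}\dfrac{A^mB^{m+1}}{4^{2m}(m!)^2}&\text{for } n=2m+1,\\[2mm]\dfrac{a^mb^{m+1}}{4^{2m}(m!)^2}&\text{for } n=-2m-1.\end{cases}$$
   Context: Let $P(x)=ae^{-2ix}+Ae^{2ix}$, $Q(x)=be^{-2ix}+Be^{2ix}$, with Fourier coefficients $p(-2)=a$, $p(2)=A$, $q(-2)=b$, $q(2)=B$, and $p(k)=q(k)=0$ for $k\ne\pm2$. Eigenvalues: consider $Ly=i\begin{pmatrix}1&0\\0&-1\end{pmatrix}y'+\begin{pmatrix}0&P\\Q&0\end{pmatrix}y$ on $[0,\pi]$ with periodic ($y(\pi)=y(0)$) or antiperiodic ($y(\pi)=-y(0)$) boundary conditions. It is known that for $|n|$ large enough the disc $\{|\lambda-n|<1/2\}$ contains exactly two (counted with algebraic multiplicity) periodic (if $n$ is even) or antiperiodic (if $n$ is odd) eigenvalues $\lambda_n^-,\lambda_n^+$, ordered so that $\operatorname{Re}\lambda_n^-<\operatorname{Re}\lambda_n^+$, or the real parts are equal and $\operatorname{Im}\lambda_n^-\le\operatorname{Im}\lambda_n^+$. Put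 $z_n^\pm=\lambda_n^\pm-n$. Functions: for $|n|$ large and $|z|\le1/2$ put (all $j_k\in n+2\mathbb{Z}$, $j_k\neq n$) $$\alpha_n(z)=\sum_{\nu\ge1}\sum_{j_1,\dots,j_{2\nu-1}}\frac{p(-n-j_1)q(j_1+j_2)\cdots p(-j_{2\nu-2}-j_{2\nu-1})q(j_{2\nu-1}+n)}{(n-j_1+z)\cdots(n-j_{2\nu-1}+z)},$$ $$\beta_n^+(z)=q(2n)+\sum_{\nu\ge1}\sum_{j_1,\dots,j_{2\nu}}\frac{q(n+j_1)p(-j_1-j_2)\cdots p(-j_{2\nu-1}-j_{2\nu})q(j_{2\nu}+n)}{(n-j_1+z)\cdots(n-j_{2\nu}+z)},$$ $$\beta_n^-(z)=p(-2n)+\sum_{\nu\ge1}\sum_{j_1,\dots,j_{2\nu}}\frac{p(-n-j_1)q(j_1+j_2)\cdots q(j_{2\nu-1}+j_{2\nu})p(-j_{2\nu}-n)}{(n-j_1+z)\cdots(n-j_{2\nu}+z)}.$$ It is known that for $|n|$ large, $z_n^-,z_n^+$ are exactly the roots (with multiplicity) in $|z|\le1/2$ of $(z-\alpha_n(z))^2=\beta_n^-(z)\beta_n^+(z)$. Walks: an admissible walk from $-n$ to $n$ is a sequence $x=(x_t)_{t=1}^{2\nu+1}$ with $x_t=\pm2$, $\sum x_t=2n$, whose vertices $j_k=-n+\sum_{t\le k}x_t$ ($1\le k\le2\nu$) satisfy $j_1,j_3,\dots,j_{2\nu-1}\ne n$ and $j_2,j_4,\dots,j_{2\nu}\ne-n$.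 Put $$h^+(x,z)=\frac{q(x_1)p(x_2)q(x_3)\cdots p(x_{2\nu})q(x_{2\nu+1})}{(n-j_1+z)(n+j_2+z)\cdots(n-j_{2\nu-1}+z)(n+j_{2\nu}+z)}.$$ Let $X_n(r)$ be the set of admissible walks from $-n$ to $n$ with exactly $r$ negative steps if $n>0$, or exactly $r$ positive steps if $n<0$, and $\sigma_r^+(n,z)=\sum_{x\in X_n(r)}h^+(x,z)$; then $\beta_n^+(z)=\sum_{r\ge0}\sigma_r^+(n,z)$. The statement ''if $z=O(1/m)$'' means: for every constant $K>0$ the estimate holds uniformly for $|z|\le K/m$ and $m$ large, with $O$-constant depending only on $K,a,A,b,B$. Other $O$-constants depend only on $a,A,b,B$. *)

(* Defs.v *)
From mathcomp Require Import all_boot all_order all_algebra.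
From mathcomp Require Import all_classical all_reals all_analysis.
From mathcomp Require Import complex.

Set Implicit Arguments.
Unset Strict Implicit.
Unset Printing Implicit Defensive.

Import Order.TTheory GRing.Theory Num.Theory.
Import numFieldNormedType.Exports.

Local Open Scope classical_set_scope.
Local Open Scope ring_scope.
Local Open Scope complex_scope.

Section Potentials.
Variable R : realType.
Implicit Types a A : R[i].

Definition expi (t : R) : R[i] := cos t +i* sin t.

Definition potential a A (x : R) : R[i] :=
  a * expi (- (2 * x)) + A * expi (2 * x).

(* Fourier coefficients of [potential a A] in the basis e^{ikx}. *)
Definition fourier_coef a A (k : int) : R[i] :=
  if k == -2 then a else if k == 2 then A else 0.

End Potentials.

Section DiracOperator.
Variable R : realType.
Variables P Q : R -> R[i].
Implicit Types (y w : R -> R[i] * R[i]) (lam mu : R[i]) (n : int).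

(* The topology of R[i] is carried by R[i]^o, and is only that of a normed module
   over R[i], not over R; so the derivative of a
   complex-valued function of a real variable is taken componentwise. *)
Definition is_cderive (f : R -> R[i]) (x : R) (d : R[i]) : Prop :=
  is_derive x 1 (fun t => complex.Re (f t)) (complex.Re d) /\
  is_derive x 1 (fun t => complex.Im (f t)) (complex.Im d).

(* (L - lam) y = w on [0, pi] with y periodic (n even) or antiperiodic (n odd).
   Only used when w is itself continuous on [0, pi]: P and Q being smooth, every
   root function is C^1 up to the end points, hence the equation is required
   pointwise in the interior and y continuous on the closed interval. *)
Definition dirac_shift n lam y w : Prop :=
  [/\ {within `[0, pi], continuous (fun x => (y x).1 : R[i]^o)},
      {within `[0, pi], continuous (fun x => (y x).2 : R[i]^o)},
      (y pi).1 = (-1) ^+ `|n|%N * (y 0).1,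
      (y pi).2 = (-1) ^+ `|n|%N * (y 0).2 &
      forall x : R, x \in `]0, pi[ -> exists d1 d2 : R[i],
        [/\ is_cderive (fun t => (y t).1) x d1,
            is_cderive (fun t => (y t).2) x d2,
            'i * d1 + P x * (y x).2 - lam * (y x).1 = (w x).1 &
            - 'i * d2 + Q x * (y x).1 - lam * (y x).2 = (w x).2]].

(* y lies in the domain of (L - lam)^k and is annihilated by it; only the values
   on [0, pi] matter. *)
Fixpoint killed_by_power n lam (k : nat) y : Prop :=
  if k is k'.+1 then exists w, dirac_shift n lam y w /\ killed_by_power n lam k' w
  else forall x : R, x \in `[0, pi] -> y x = (0, 0).

Definition root_function n lam y : Prop := exists k, killed_by_power n lam k y.

(* The root subspace of lam has dimension k: the e i are root functions in which
   every root function has unique coordinates.  For k = 0, lam is not an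
   eigenvalue. *)
Definition algebraic_multiplicity n lam (k : nat) : Prop :=
  exists e : 'I_k -> R -> R[i] * R[i],
    (forall i, root_function n lam (e i)) /\
    (forall y, root_function n lam y ->
       exists! c : {ffun 'I_k -> R[i]}, forall x : R, x \in `[0, pi] ->
         (y x).1 = \sum_i c i * (e i x).1 /\
         (y x).2 = \sum_i c i * (e i x).2).

(* (lm, lp) = (lambda_n^-, lambda_n^+). *)
Definition eigenvalue_pair n (lm lp : R[i]) : Prop :=
  [/\ `|lm - n%:~R| < 2^-1,
      `|lp - n%:~R| < 2^-1,
      forall mu, `|mu - n%:~R| < 2^-1 ->
        algebraic_multiplicity n mu ((mu == lm) + (mu == lp))%N &
      complex.Re lm < complex.Re lp \/
      complex.Re lm = complex.Re lp /\ complex.Im lm <= complex.Im lp].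

End DiracOperator.

Section BetaPlus.
Variable R : realType.
Variables p q : int -> R[i].
Implicit Types (n : int) (z : R[i]).

(* With s = (n, j_1, ..., j_2v, n), the factors are q (s_i + s_{i+1}) for even i
   and p (- s_i - s_{i+1}) for odd i. *)
Definition beta_numerator n (j : seq int) : R[i] :=
  let s := n :: rcons j n in
  \prod_(i < (size j).+1)
    (if odd i then p (- s`_i - s`_i.+1) else q (s`_i + s`_i.+1)).

Definition beta_indices n (k : nat) : set (k.-tuple int) :=
  [set j : k.-tuple int | all (fun i : int => (2 %| i - n)%Z && (i != n)) j].
Arguments beta_indices : clear implicits.

(* A sum with finite support as soon as p and q have finite support. *)
Definition beta_summand n z (v : nat) : R[i] :=
  \sum_(j \in beta_indices n v.*2)
    (beta_numerator n j / \prod_(i <- j) (n%:~R - i%:~R + z)).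

Definition beta_plus n z : R[i] :=
  q (2 * n) + limn (fun N => \sum_(1 <= v < N) beta_summand n z v : R[i]^o).

End BetaPlus.

Section Walks.
Variable R : realType.
Variables p q : int -> R[i].
Implicit Types (n : int) (x : seq int) (z : R[i]).

(* Walks are sequences of steps; step x_t is the entry of index t - 1. *)
Definition vertex n x (k : nat) : int := - n + \sum_(t <- take k x) t.

Definition admissible n x : Prop :=
  [/\ odd (size x),
      all (fun t : int => (t == 2) || (t == -2)) x,
      \sum_(t <- x) t = 2 * n &
      forall k, (0 < k < size x)%N ->
        vertex n x k <> (if odd k then n else - n)].

Definition walk_weight n x z : R[i] :=
  (\prod_(t < size x) (if odd t then p x`_t else q x`_t)) /
  \prod_(1 <= k < size x)
    (if odd k then n%:~R - (vertex n x k)%:~R + z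
     else n%:~R + (vertex n x k)%:~R + z).

(* Backward steps are the negative ones for n > 0, the positive ones for
   n < 0. *)
Definition walks n (r : nat) : set (seq int) :=
  [set x | admissible n x /\
    count (fun t : int => if 0 < n then t < 0 else 0 < t) x = r].

(* [walks n r] is finite: its members have length |n| + 2r. *)
Definition sigma_plus (r : nat) n z : R[i] :=
  \sum_(x \in walks n r) walk_weight n x z.

End Walks.

(* Main.v *)
Require Import Defs.
From mathcomp Require Import all_boot all_order all_algebra.
From mathcomp Require Import all_classical all_reals all_analysis.
From mathcomp Require Import complex.
From mathcomp Require Import ring lra zify.
Import Order.TTheory GRing.Theory Num.Theory.
Import numFieldNormedType.Exports.
Local Open Scope ring_scope.
Local Open Scope complex_scope.

Set Implicit Arguments.
Unset Strict Implicit.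
Unset Printing Implicit Defensive.

(** Write [n = sg * N] with [N = 2 m + 1] and [sg] a sign, and a vertex of a walk as
    [sg * (2 s - N)]. An admissible walk from [- n] to [n] then becomes a
    nearest-neighbour walk of the position [s] from 0 to [N] that stays strictly
    between 0 and [N] before the end, and the factors of the denominator depend on
    the position only: with [zeta = sg * z] they are [d_s = sg * (gap_s + zeta)], where
    [gap_s] is [2 s] for even [s] and [2 (N - s)] for odd [s]. So beta is an entry of
    the inverse of a tridiagonal matrix, and eliminating the sites one by one gives
    a closed form ([beta_plusE]): the product of the forward weights over [s < N]
    divided by the product of the pivots [e_s], where [e_1 = d_1] and
    [e_(s+1) = d_(s+1) - g_s / e_s], [g_s] being the product of the weights of the steps
    from [s] to [s+1] and back. The leading term [sigma_0] at [z = 0] has the same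
    numerator over the product of the [sg * gap_s] ([sigma_plus0E]), which is also
    the explicit formula.

    Hence beta divided by [sigma_0] is the inverse of a product of factors
    [1 + zeta / gap_s] and [1 - delta_s], where [delta_s] is of the order of
    [1 / (gap_(s-1) * gap_s)] ([beta_ratio]). The inverse gaps sum to half the
    harmonic number [H_m], the inverse products of consecutive gaps to
    [O (H_m / m)], so all the deviations together are
    [O (H_m * (|z| + 1 / m))]: this is the first estimate. Up to the square of this
    quantity the deviation from 1 is the linear one,
    [- zeta * H_m / 2 + (a B + A b) * H_m / (8 m) + O (H_m / m ^ 2)],
    which cancels to the order required when [zeta] is
    [(a B + A b) / (4 m) + O (1 / m ^ 2)] ([S_second_order]).

    That the shifts [z_n] have this form is read off the differential equation
    ([resonant_eigenvalue]). Given an eigenfunction [(y1, y2)], averaging replaces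
    [y1] by [W = y1 + O (1 / n)], a combination of [y1] and [y2] with coefficients of
    period [pi], for which [W' = i (kappa - lam) W + O (1 / n ^ 2)] with
    [kappa = a B / (2 lam - 2) + A b / (2 lam + 2)]. As [W] is periodic or antiperiodic
    together with [y1], [e ^ (i (z - kappa) pi) - 1] is [O (1 / n ^ 2)], unless [y1] is
    small; in that case the same argument applies to [y2]. Therefore
    [z = kappa + O (1 / n ^ 2) = (a B + A b) / (2 n) + O (1 / n ^ 2)]. *)

(** The norm of [R[i]] is itself complex valued, with a partial order; all the
    estimates below are made in the ordered field [R], through [normc]. *)
Local Notation normc := (@Normc.normc _).

(** * The modulus as a real number *)
Section Modulus.
Variable R : realType.
Implicit Types (x y z : R[i]).

Lemma normcE z : `|z| = (normc z)%:C. Proof. by case: z. Qed.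

Lemma le_cmod z (r : R) : (`|z| <= r%:C) = (normc z <= r).
Proof. by rewrite normcE lecR. Qed.

Lemma lt_cmod z (r : R) : (`|z| < r%:C) = (normc z < r).
Proof. by rewrite normcE ltcR. Qed.

Lemma normc_ge0 z : 0 <= normc z. Proof. by case: z => ? ?; exact: sqrtr_ge0. Qed.

Lemma normc_0 : normc (0 : R[i]) = 0. Proof. exact: Normc.normc0. Qed.
Lemma normc_1 : normc (1 : R[i]) = 1. Proof. exact: Normc.normc1. Qed.

Lemma normc_eq0 z : (normc z == 0) = (z == 0).
Proof.
by apply/eqP/eqP => [/Normc.eq0_normc//|->]; rewrite normc_0.
Qed.

Lemma normc_gt0 z : (0 < normc z) = (z != 0).
Proof. by rewrite lt_neqAle normc_ge0 andbT eq_sym normc_eq0. Qed.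

Lemma ler_normcD x y : normc (x + y) <= normc x + normc y.
Proof. exact: le_normcD. Qed.

Lemma normc_opp z : normc (- z) = normc z. Proof. exact: normcN. Qed.

Lemma ler_normcB x y : normc (x - y) <= normc x + normc y.
Proof. by rewrite -(normc_opp y) ler_normcD. Qed.

Lemma ler_subnormc x y : normc x - normc y <= normc (x - y).
Proof. by rewrite lerBlDr -{1}(subrK y x) ler_normcD. Qed.

Lemma normc_mul x y : normc (x * y) = normc x * normc y.
Proof. exact: Normc.normcM. Qed.

Lemma normc_inv x : normc x^-1 = (normc x)^-1.
Proof. exact: Normc.normcV. Qed.

Lemma normc_nat k : normc (k%:R : R[i]) = k%:R.
Proof.
have -> : (k%:R : R[i]) = (k%:R : R)%:C by rewrite rmorph_nat.
by rewrite /= expr0n /= addr0 sqrtr_sqr ger0_norm.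
Qed.

Lemma normc_real (r : R) : normc r%:C = `|r|.
Proof. by rewrite /= expr0n /= addr0 sqrtr_sqr. Qed.

Lemma ler_normc_sum I (r : seq I) (F : I -> R[i]) :
  normc (\sum_(i <- r) F i) <= \sum_(i <- r) normc (F i).
Proof.
elim: r => [|i r IH]; first by rewrite !big_nil normc_0.
by rewrite !big_cons (le_trans (ler_normcD _ _)) ?lerD2l.
Qed.

End Modulus.

(** * Products of factors close to 1 *)
Section ProductPerturbation.
Variable R : realType.

(** Induction on the number of factors: multiplying by [1 - f] changes the error
    by [f] times the deviation of the product from 1, which is at most [2 t |f|],
    the growth of [t ^+ 2]. *)
Lemma prod_sub1_second_order I (r : seq I) (F : I -> R[i]) :
  let t := \sum_(i <- r) normc (F i) in t <= 1 ->
  normc (\prod_(i <- r) (1 - F i) - 1 + \sum_(i <- r) F i) <= t ^+ 2.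
Proof.
elim: r => [|i r IH] /=; first by rewrite !big_nil subrr addr0 normc_0 expr0n.
rewrite !big_cons; set f := F i; set t := \sum_(j <- r) _.
set P := \prod_(j <- r) _; set S := \sum_(j <- r) _ => tf1.
have f0 := normc_ge0 f.
have t0 : 0 <= t by apply: sumr_ge0 => ? _; exact: normc_ge0.
have /IH {}IH : t <= 1 by lra.
have S_le : normc S <= t by exact: ler_normc_sum.
have P_le : normc (P - 1) <= t + t ^+ 2.
  have -> : P - 1 = (P - 1 + S) - S by ring.
  by apply: le_trans (ler_normcB _ _) _; rewrite addrC lerD.
have -> : (1 - f) * P - 1 + (f + S) = (P - 1 + S) - f * (P - 1) by ring.
apply: le_trans (ler_normcB _ _) _; rewrite normc_mul.
have : normc f * normc (P - 1) <= normc f * (t + t ^+ 2) by rewrite ler_wpM2l.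
have : normc f * t ^+ 2 <= normc f * t.
  by rewrite ler_wpM2l // expr2 ler_piMr //; lra.
have := sqr_ge0 (normc f); move: IH; rewrite sqrrD mulrDr -/t -/f.
move: (normc _ ^+ 2) (normc f * normc _) (normc (_ - 1 + _)) => *.
rewrite -mulr_natr; lra.
Qed.

(** The linear term is kept apart from [t ^+ 2] because, at an eigenvalue, it is
    much smaller than the sum [t] of the moduli. *)
Lemma inv_prod_sub1 I (r : seq I) (F : I -> R[i]) :
  let t := \sum_(i <- r) normc (F i) in t <= 1 / 4 ->
  \prod_(i <- r) (1 - F i) != 0 /\
  normc ((\prod_(i <- r) (1 - F i))^-1 - 1)
    <= 2 * (normc (\sum_(i <- r) F i) + t ^+ 2).
Proof.
move=> t t4; have t0 : 0 <= t by apply: sumr_ge0 => ? _; exact: normc_ge0.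
have := @prod_sub1_second_order _ r F; rewrite -/t => /(_ ltac:(lra)).
set P := \prod_(i <- r) _; set S := \sum_(i <- r) _ => PS.
have S_le : normc S <= t by exact: ler_normc_sum.
have P_le : normc (P - 1) <= normc S + t ^+ 2.
  have -> : P - 1 = (P - 1 + S) - S by ring.
  by apply: le_trans (ler_normcB _ _) _; rewrite addrC lerD.
have P_ge : 1 / 2 <= normc P.
  have := ler_subnormc 1 (1 - P).
  have -> : 1 - (1 - P) = P by ring.
  by rewrite normc_1 -(normc_opp (1 - P)) opprB; nra.
have P0 : P != 0 by rewrite -normc_gt0; lra.
split=> //.
have -> : P^-1 - 1 = - ((P - 1) * P^-1) by field.
rewrite normc_opp normc_mul normc_inv mulrC.
have iP : (normc P)^-1 <= 2.
  by rewrite -[leRHS]invrK lef_pV2 ?posrE; lra.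
apply: ler_pM => //; [by rewrite invr_ge0 normc_ge0 | exact: normc_ge0].
Qed.

End ProductPerturbation.

(** * Gaussian elimination in a tridiagonal system *)
Section ContinuedFraction.
Variable R : realType.
Variables d g : nat -> R[i].

(** The pivots met when a tridiagonal matrix with diagonal [d] is eliminated from
    site 1 on, [g s] being the product of the two entries that couple the sites
    [s] and [s.+1]. *)
Fixpoint pivot (s : nat) : R[i] :=
  if s is s'.+1 then d s - (if s' == 0%N then 0 else g s' / pivot s') else 1.

(** The relative amount by which elimination changes the diagonal entry [d s];
    see [pivotE]. *)
Definition pivot_defect (s : nat) : R[i] :=
  if s == 1%N then 0 else g s.-1 / (d s * pivot s.-1).

Lemma pivotS s : (0 < s)%N -> pivot s.+1 = d s.+1 - g s / pivot s.
Proof. by case: s. Qed.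

Variable N : nat.
Hypothesis d_neq0 : forall s, (0 < s < N)%N -> d s != 0.
Hypothesis g_small : forall s, (0 < s)%N -> (s.+1 < N)%N ->
  4 * normc (g s) <= normc (d s) * normc (d s.+1).

Lemma pivot_ge s : (0 < s < N)%N -> normc (d s) / 2 <= normc (pivot s).
Proof.
elim: s => // s IH /andP[_ sN].
have [->|s0] := eqVneq s 0%N.
  by rewrite /= subr0; have := normc_ge0 (d 1); lra.
rewrite pivotS ?lt0n //.
have s_in : (0 < s < N)%N by rewrite lt0n s0 ltnW.
have := g_small (s:=s); rewrite lt0n s0 sN => /(_ isT isT) gs.
have ds : 0 < normc (d s) by rewrite normc_gt0 d_neq0.
have {IH} := IH s_in => ps.
have p0 : 0 < normc (pivot s) by lra.
have := ler_subnormc (d s.+1) (g s / pivot s).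
rewrite normc_mul normc_inv => h.
suff : normc (g s) / normc (pivot s) <= normc (d s.+1) / 2 by lra.
rewrite ler_pdivrMr //; have := normc_ge0 (d s.+1); nra.
Qed.

Lemma pivot_neq0 s : (0 < s < N)%N -> pivot s != 0.
Proof.
move=> sN; rewrite -normc_gt0; have := pivot_ge sN.
have : 0 < normc (d s) by rewrite normc_gt0 d_neq0.
lra.
Qed.

Lemma pivotE s : (0 < s < N)%N -> pivot s = d s * (1 - pivot_defect s).
Proof.
case: s => // -[|s] sN; rewrite /pivot_defect.
  by rewrite /= subr0 subr0 mulr1.
rewrite pivotS //= mulrBr mulr1; congr (_ - _).
have : pivot s.+1 != 0 by apply: pivot_neq0; lia.
have := d_neq0 sN => ? ?; rewrite -/(pivot s.+1); field.
by apply/andP.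
Qed.

Lemma pivot_defect_le s : (0 < s)%N -> (s.+1 < N)%N ->
  normc (pivot_defect s.+1) <= 2 * normc (g s) / (normc (d s) * normc (d s.+1)).
Proof.
move=> s0 sN; rewrite /pivot_defect eqSS eqn0Ngt s0 /=.
rewrite !normc_mul normc_inv normc_mul.
have ps : normc (d s) / 2 <= normc (pivot s) by apply: pivot_ge; lia.
have d0 : 0 < normc (d s) by rewrite normc_gt0 d_neq0; lia.
have d1 : 0 < normc (d s.+1) by rewrite normc_gt0 d_neq0; lia.
have p0 : 0 < normc (pivot s) by lra.
rewrite -[X in X <= _]mulr1 ler_pdivlMr ?mulr_gt0 // mulr1.
rewrite mulrAC ler_pdivrMr ?mulr_gt0 //.
have := normc_ge0 (g s) => g0.
rewrite [leRHS](_ : _ = normc (g s) * normc (d s.+1) * (2 * normc (pivot s))); last by ring.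
rewrite [leLHS](_ : _ = normc (g s) * normc (d s.+1) * normc (d s)); last by ring.
by apply: ler_wpM2l; [rewrite mulr_ge0 // ltW | lra].
Qed.

End ContinuedFraction.

(** * Nearest-neighbour walks confined between two sites *)
Section Neumann.
Variable R : realType.
Variables (N : nat) (up dn d : nat -> R[i]).

(** Sites 0 and [N] end the walk: the steps counted here lead to a site strictly
    between them, and carry the inverse of the [d] of the site they reach. *)
Definition hop (f : nat -> R[i]) (s : nat) : R[i] :=
  (if (s.+1 < N)%N then up s / d s.+1 * f s.+1 else 0) +
  (if (1 < s)%N then dn s / d s.-1 * f s.-1 else 0).

(** The sum of the weights of the walks from [s] to [N] with exactly [k] sites in
    between. *)
Fixpoint walk_sum (k s : nat) : R[i] :=
  if k is k'.+1 then hop (walk_sum k') s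
  else if s.+1 == N then up s else 0.

(** Every step changes the parity of the site, and the last one leaves the even
    site [N.-1]. *)
Lemma walk_sum_parity k s : (s < N)%N -> odd N -> odd k != odd s -> walk_sum k s = 0.
Proof.
elim: k s => [|k IH] s sN oN /=.
  move=> so; case: (s.+1 =P N) => // sN'.
  by move: oN so; rewrite -sN' /=; case: odd.
move=> ks; rewrite /hop; case: ifP => h1; case: ifP => h2; rewrite ?IH ?mulr0 ?addr0 //.
- by lia.
- by move: ks; rewrite /=; case: (s) h2 => //= ?; do 2!case: odd.
- by move: ks; rewrite /=; do 2!case: odd.
- by move: ks; rewrite /=; do 2!case: odd.
- by lia.
- by move: ks; rewrite /=; case: (s) h2 => //= ?; do 2!case: odd.
Qed.

Let g s := dn s.+1 * up s.
Local Notation e := (pivot d g).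

(** The sum over all walks from [s] to [N], the weight of the site [s] included.
    It has this product form because, once the sites below [s] are eliminated, a
    walk can only move on from [s] to [s.+1], with the weight [up s / e s]. *)
Definition hit (s : nat) : R[i] := \prod_(s <= i < N) (up i / e i).

(** The same sum without the weight of the site where the walk starts. *)
Definition hit_from (s : nat) : R[i] := if s == 0%N then up 0 * hit 1 else d s * hit s.

Hypothesis N1 : (1 < N)%N.
Hypothesis d_neq0 : forall s, (0 < s < N)%N -> d s != 0.
Hypothesis e_neq0 : forall s, (0 < s < N)%N -> e s != 0.

Lemma hitS s : (s < N)%N -> hit s = up s / e s * hit s.+1.
Proof. by move=> sN; rewrite /hit big_ltn. Qed.

Lemma hitN : hit N = 1. Proof. by rewrite /hit big_geq. Qed.

(** Decomposition according to the first step. At a site [s > 0] it is the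
    recurrence that defines the pivots. *)
Lemma hit_from_fix s : (s < N)%N -> hit_from s = walk_sum 0 s + hop hit_from s.
Proof.
move=> sN; rewrite /hop /=.
have -> : (if s.+1 == N then up s else 0) +
   ((if (s.+1 < N)%N then up s / d s.+1 * hit_from s.+1 else 0) +
    (if (1 < s)%N then dn s / d s.-1 * hit_from s.-1 else 0)) =
  up s * hit s.+1 + (if (1 < s)%N then dn s * hit s.-1 else 0).
  rewrite addrA; congr (_ + _).
    case: ltngtP => [sN'|sN'|->]; last by rewrite hitN mulr1 addr0.
    - by rewrite add0r /hit_from /= mulrA mulfVK // d_neq0.
    - by lia.
  case: ifP => // s1; rewrite /hit_from ifF; last by lia.
  by rewrite mulrA mulfVK // d_neq0 //; lia.
rewrite /hit_from; case: eqP => [->|s0]; first by rewrite ltn0 addr0.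
case: s s0 sN => // s _ sN; rewrite /= ltnS.
have es : e s.+1 != 0 by apply: e_neq0; lia.
case: posnP => [->|s0].
  rewrite addr0 hitS // mulrA; congr (_ * _).
  rewrite /= subr0 mulrCA divff ?mulr1 //; exact: d_neq0.
rewrite [hit s]hitS; last by lia.
rewrite hitS // in es *.
have es' : e s != 0 by apply: e_neq0; lia.
move: (pivotS d g s0); rewrite {1 2}/g => E.
have {1}-> : d s.+1 = e s.+1 + dn s.+1 * up s / e s by rewrite E subrK.
field; exact/andP.
Qed.

Let defect K s := hit_from s - \sum_(k < K) walk_sum k s.

(** The error of the partial sums of the walk series is propagated by [hop]. *)
Lemma defectS K s : (s < N)%N -> defect K.+1 s = hop (defect K) s.
Proof.
move=> sN; rewrite /defect hit_from_fix // big_ord_recl /=.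
rewrite [X in _ - (_ + X)](_ : _ = hop (fun s => \sum_(k < K) walk_sum k s) s).
  by rewrite /hop; do 3!case: ifP => _; ring.
rewrite /hop; elim: K => [|K IH].
  by rewrite !big_ord0 !mulr0; do 2!case: ifP => _; rewrite addr0.
rewrite big_ord_recr /= IH !(big_ord_recr K) /= /hop.
by do 2!case: ifP => _; ring.
Qed.

Variable c : R.
Hypothesis up_le : forall s, normc (up s) <= c.
Hypothesis dn_le : forall s, normc (dn s) <= c.
Hypothesis d_large : forall s, (0 < s)%N -> (s.+1 < N)%N ->
  8 * c ^+ 2 <= normc (d s) * normc (d s.+1).

Lemma two_hops_le (u v x y f : R[i]) (S : R) : normc u <= c -> normc v <= c ->
  x != 0 -> y != 0 -> 8 * c ^+ 2 <= normc x * normc y -> normc f <= S ->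
  normc (u / x * (v / y * f)) <= S / 8.
Proof.
move=> uc vc x0 y0 xy fS.
have -> : u / x * (v / y * f) = u * v * f / (x * y) by field; exact/andP.
rewrite normc_mul normc_inv !normc_mul.
rewrite -normc_gt0 in x0; rewrite -normc_gt0 in y0.
rewrite ler_pdivrMr ?mulr_gt0 //.
have S0 : 0 <= S by apply: le_trans fS; exact: normc_ge0.
apply: (@le_trans _ _ (c * c * S)).
  by rewrite ler_pM ?mulr_ge0 ?normc_ge0 // ler_pM ?normc_ge0.
rewrite -expr2.
have -> : S / 8 * (normc x * normc y) = normc x * normc y * (S / 8) by ring.
have -> : c ^+ 2 * S = 8 * c ^+ 2 * (S / 8) by field.
by rewrite ler_wpM2r //; lra.
Qed.

(** A single step need not contract, since some [d s] stay bounded; but two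
    consecutive sites never both have a small [d], so two steps do. *)
Lemma hop2_le (f : nat -> R[i]) (S : R) s : (s < N)%N ->
  (forall s, (s < N)%N -> normc (f s) <= S) -> normc (hop (hop f) s) <= S / 2.
Proof.
move=> sN fS.
have S8 : 0 <= S / 8.
  by rewrite divr_ge0 //; apply: le_trans (normc_ge0 _) (fS 0%N _); lia.
have aux1 : (s.+1 < N)%N -> normc (up s / d s.+1 * hop f s.+1) <= S / 8 + S / 8.
  move=> s1; rewrite /hop mulrDr; apply: le_trans (ler_normcD _ _) _.
  apply: lerD; case: ifP => h; rewrite ?mulr0 ?normc_0 //.
    apply: two_hops_le => //; rewrite ?d_neq0 ?d_large ?fS //; lia.
  apply: two_hops_le => //; rewrite ?d_neq0 ?fS //; try lia.
  by rewrite /= [leRHS]mulrC d_large //; lia.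
have aux2 : (1 < s)%N -> normc (dn s / d s.-1 * hop f s.-1) <= S / 8 + S / 8.
  case: s sN {aux1} => // s sN s1; rewrite /hop mulrDr.
  apply: le_trans (ler_normcD _ _) _.
  apply: lerD; case: ifP => h; rewrite ?mulr0 ?normc_0 //=.
    apply: two_hops_le => //; rewrite ?d_neq0 ?d_large ?fS //; lia.
  case: s h sN s1 => // s h sN s1.
  apply: two_hops_le => //; rewrite ?d_neq0 ?fS //=; try lia.
  by rewrite /= [leRHS]mulrC d_large //; lia.
rewrite {1}/hop; apply: le_trans (ler_normcD _ _) _.
have -> : S / 2 = S / 8 + S / 8 + (S / 8 + S / 8) by field.
apply: lerD; case: ifP => h; rewrite ?normc_0 ?addr_ge0 //; [exact: aux1|exact: aux2].
Qed.

Lemma walk_sum_converges : odd N -> exists S : R, forall V,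
  normc (up 0 * hit 1 - \sum_(v < V) walk_sum v.*2 0) <= S / 2 ^+ V.
Proof.
move=> oN; exists (\sum_(s < N) normc (hit_from s)) => V.
suff H s : (s < N)%N ->
    normc (defect V.*2 s) <= (\sum_(s < N) normc (hit_from s)) / 2 ^+ V.
  have := H 0%N ltac:(lia); rewrite /defect /hit_from eqxx.
  suff -> : \sum_(k < V.*2) walk_sum k 0 = \sum_(v < V) walk_sum v.*2 0 by [].
  elim: V {H} => [|V IH]; first by rewrite !big_ord0.
  have E : walk_sum V.*2.+1 0 = 0.
    by rewrite walk_sum_parity // ?(ltn_trans _ N1) //= odd_double.
  rewrite doubleS 3!big_ord_recr IH.
  rewrite [LHS](_ : _ = \sum_(v < V) walk_sum v.*2 0 + walk_sum V.*2 0
    + walk_sum V.*2.+1 0) //.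
  by rewrite E addr0.
elim: V s => [|V IH] s sN.
  rewrite expr0 divr1 /defect big_ord0 subr0.
  rewrite (bigD1 (Ordinal sN)) //= lerDl sumr_ge0 // => *; exact: normc_ge0.
rewrite doubleS defectS //.
have -> : hop (defect V.*2.+1) s = hop (hop (defect V.*2)) s.
  by rewrite {1 2}/hop; congr (_ + _); case: ifP => // h; rewrite defectS //; lia.
rewrite exprSr invfM mulrA.
exact: hop2_le.
Qed.

End Neumann.

(** * The series of beta as a series over confined walks *)
Section PathExpansion.
Variable R : realType.
Variables p q : int -> R[i].
Hypothesis p_supp : forall k, k != 2 -> k != -2 -> p k = 0.
Hypothesis q_supp : forall k, k != 2 -> k != -2 -> q k = 0.
Variables (sg : int) (N : nat).
Hypothesis sg1 : sg = 1 \/ sg = -1.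
Hypothesis oN : odd N.
Hypothesis N1 : (1 < N)%N.
Variable z : R[i].

Let n : int := sg * N%:Z.

(** With [n = sg * N] the vertices of a walk are [sg * (2 s - N)], [s] being its
    position. The indices [j_k] of the series are the vertices at odd times and
    their opposites at even times, hence the dependence on parity; both [s = 0]
    and [s = N] give the excluded index [n]. *)
Definition site (s : int) : int :=
  sg * (if odd `|s|%N then 2 * s - N%:Z else N%:Z - 2 * s).

Definition up_weight (s : nat) : R[i] := if odd s then p (2 * sg) else q (2 * sg).
Definition dn_weight (s : nat) : R[i] :=
  if odd s then p (- (2 * sg)) else q (- (2 * sg)).
Definition site_den (s : nat) : R[i] := n%:~R - (site s)%:~R + z.

Let step (b : bool) (x y : int) : R[i] := if b then p (- x - y) else q (x + y).

(** The summand of the series peeled off from the left, [b] telling whether the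
    next factor is a value of [p]. *)
Fixpoint tail_weight (b : bool) (x : int) (j : seq int) : R[i] :=
  if j is y :: j' then step b x y / (n%:~R - y%:~R + z) * tail_weight (~~ b) y j'
  else step b x n.

Lemma tail_weightE b x j :
  let s := x :: rcons j n in
  (\prod_(i < (size j).+1) step (odd i (+) b) s`_i s`_i.+1) /
    \prod_(i <- j) (n%:~R - i%:~R + z) = tail_weight b x j.
Proof.
elim: j b x => [|y j IH] b x /=.
  by rewrite big_ord1 big_nil divr1.
rewrite big_ord_recl big_cons /= -IH /= invfM.
have -> : \prod_(i < (size j).+1) step (odd (bump 0 i) (+) b)
      (x :: y :: rcons j n)`_(bump 0 i) (y :: rcons j n)`_(bump 0 i) =
    \prod_(i < (size j).+1) step (odd i (+) ~~ b) (y :: rcons j n)`_i (rcons j n)`_i.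
  by apply: eq_bigr => i _; rewrite /bump /= addbN addNb.
ring.
Qed.

Lemma stepE s y : step (odd `|s|%N) (site s) y =
  if odd `|s|%N then p (sg * (N%:Z - 2 * s) - y) else q (sg * (N%:Z - 2 * s) + y).
Proof.
by rewrite /step /site; case: odd => //; congr (p _); ring.
Qed.

Lemma odd_abszS (s : int) : odd `|(s + 1)%R|%N = ~~ odd `|s|%N.
Proof. lia. Qed.

Lemma odd_abszP (s : int) : odd `|(s - 1)%R|%N = ~~ odd `|s|%N.
Proof. lia. Qed.

Lemma step_up s : step (odd `|s|%N) (site s) (site (s + 1)) =
  if odd `|s|%N then p (2 * sg) else q (2 * sg).
Proof.
rewrite stepE /site odd_abszS.
by case: odd => /=; [congr (p _)|congr (q _)]; ring.
Qed.

Lemma step_dn s : step (odd `|s|%N) (site s) (site (s - 1)) =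
  if odd `|s|%N then p (- (2 * sg)) else q (- (2 * sg)).
Proof.
rewrite stepE /site odd_abszP.
by case: odd => /=; [congr (p _)|congr (q _)]; ring.
Qed.

Lemma two_point_support (f : int -> R[i]) k : (forall k, k != 2 -> k != -2 -> f k = 0) ->
  f k != 0 -> k = 2 \/ k = -2.
Proof.
move=> f_supp; have [->|k2] := eqVneq k 2; first by left.
by have [->|k3] := eqVneq k (-2); [right | rewrite f_supp ?eqxx].
Qed.

Lemma step_neq0 s y : step (odd `|s|%N) (site s) y != 0 ->
  y = site (s + 1) \/ y = site (s - 1).
Proof.
rewrite stepE /site odd_abszS odd_abszP; case: ifP => so /= h.
- have : sg * (N%:Z - 2 * s) - y = 2 \/ sg * (N%:Z - 2 * s) - y = -2.
    by apply: two_point_support h; exact: p_supp.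
  by case: sg1 => ->; lia.
have : sg * (N%:Z - 2 * s) + y = 2 \/ sg * (N%:Z - 2 * s) + y = -2.
  by apply: two_point_support h; exact: q_supp.
by case: sg1 => ->; lia.
Qed.

Lemma site0 : site 0 = n. Proof. by rewrite /site /= mulr0 subr0. Qed.
Lemma siteN : site N = n.
Proof. by rewrite /site /= oN /n; congr (_ * _); ring. Qed.

Let good := all (fun i : int => (2 %| i - n)%Z && (i != n)).

(** A walk that leaves through [- n] would have to meet it again in order to come
    back, which is forbidden, so it never reaches [n]. *)
Lemma tail_weight_outside j t b : good j -> b = ~~ odd t -> odd (size j) = b ->
  tail_weight b (site (- t.+1%:Z)) j = 0.
Proof.
elim: j t b => [|y j IH] t b.
  move=> _ to /= sb; have := @stepE (- t.+1%:Z) n; rewrite abszN /= -to -sb => ->.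
  by apply: q_supp; rewrite /n; case: sg1 => ->; apply/eqP; lia.
move=> /andP[/andP[_ yn] gj] bt /= so.
have so' : odd (size j) = ~~ b by rewrite -so negbK.
have [->|] := eqVneq (step b (site (- t.+1%:Z)) y) 0; first by rewrite !mul0r.
have -> : b = odd `|(- t.+1%:Z)%R|%N by rewrite abszN.
move=> /step_neq0[]yE; rewrite abszN /= -bt [X in _ * X](_ : _ = 0) ?mulr0 //.
  have {}yE : y = site (- t%:Z) by rewrite yE; congr site; lia.
  case: t bt yE => [|t] bt yE; first by move: yn; rewrite yE oppr0 site0 eqxx.
  by rewrite yE; apply: IH => //; rewrite bt /= negbK.
rewrite yE; have -> : (- t.+1%:Z) - 1 = - t.+2%:Z by lia.
by apply: IH => //; rewrite bt.
Qed.

(** The index tuples that contribute: those of walks confined to [1 .. N.-1]. *)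
Fixpoint paths (k s : nat) : seq (seq int) :=
  if k is k'.+1 then
    (if (s.+1 < N)%N then map (cons (site s.+1)) (paths k' s.+1) else [::]) ++
    (if (1 < s)%N then map (cons (site s.-1)) (paths k' s.-1) else [::])
  else [:: [::]].

Lemma site_inj (s t : nat) : odd s = odd t -> site s%:Z = site t%:Z -> s = t.
Proof.
by move=> st; rewrite /site /= st; case: odd; case: sg1 => ->; lia.
Qed.

Lemma site_neq (s : nat) : (0 < s < N)%N -> site s != n.
Proof.
by move=> sN; rewrite /site /n /=; apply/eqP; case: sg1 => ->; case: ifP; lia.
Qed.

Lemma site_even (s : nat) : (2 %| site s - n)%Z.
Proof.
rewrite /site /n /=; apply/dvdzP; case: (odd s).
  by exists (sg * (s%:Z - N%:Z)); ring.
by exists (- sg * s%:Z); ring.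
Qed.

Lemma paths_uniq k s : uniq (paths k s).
Proof.
elim: k s => //= k IH s; rewrite cat_uniq; apply/and3P; split.
- by case: (s.+1 < N)%N => //; rewrite map_inj_uniq // => x y /(congr1 behead).
- case: (ltnP 1 s) => // s1; case: ifP => s2; last by apply/hasPn => x; rewrite in_nil.
  apply/hasPn => _ /mapP[x _ ->]; apply/mapP => -[y _ [E _]].
  have so : odd s.-1 = odd s.+1 by lia.
  by have := site_inj so E; lia.
- by case: (1 < s)%N => //; rewrite map_inj_uniq // => x y /(congr1 behead).
Qed.

Lemma paths_good k s j : (s < N)%N -> j \in paths k s -> good j /\ size j = k.
Proof.
elim: k s j => [|k IH] s j sN /=; first by rewrite inE => /eqP->.
rewrite mem_cat => /orP[]; case: ifP => // h /mapP[j' /IH[]//]; try lia.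
  move=> gj <- -> /=; split=> //; apply/andP; split=> //.
  by rewrite site_even site_neq.
move=> gj <- -> /=; split=> //; apply/andP; split=> //.
by rewrite site_even site_neq //; lia.
Qed.

Lemma paths_complete j (s : nat) : (s < N)%N -> good j -> odd (size j) = odd s ->
  j \notin paths (size j) s -> tail_weight (odd s) (site s) j = 0.
Proof.
elim: j s => [|y j IH] s sN //= /andP[/andP[_ yn] gj] so jN.
have [->|] := eqVneq (step (odd s) (site s) y) 0; first by rewrite !mul0r.
have -> : odd s = odd `|s%:Z|%N by []. move=> /step_neq0[] yE.
  have {}yE : y = site s.+1 by rewrite yE; congr site; lia.
  have s1 : (s.+1 < N)%N.
    rewrite ltn_neqAle sN andbT; apply: contraNneq yn => sE.
    by rewrite yE sE siteN.
  rewrite yE -[~~ odd _]/(odd s.+1) IH ?mulr0 //; first by rewrite /= -so negbK.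
  apply: contraNN jN => jP; rewrite mem_cat s1 yE; apply/orP; left.
  exact: map_f.
case: s sN so jN yE => [|s] sN so jN yE.
  rewrite yE [X in _ * X](_ : _ = 0) ?mulr0 //.
  by apply: (@tail_weight_outside j 0) => //=; move: so => /=; case: odd.
have {}yE : y = site s by rewrite yE; congr site; lia.
case: s sN so jN yE => [|s] sN so jN yE.
  by move: yn; rewrite yE site0 eqxx.
rewrite yE [X in _ * X](_ : _ = 0) ?mulr0 //=.
have /= := IH s.+1; rewrite !negbK => -> //; first by lia.
- by move: so => /=; case: odd; case: odd.
apply: contraNN jN => jP; rewrite mem_cat yE; apply/orP; right.
exact: map_f.
Qed.

Lemma sum_paths k (s : nat) : (s < N)%N -> odd k = odd s ->
  \sum_(j <- paths k s) tail_weight (odd s) (site s) j =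
    walk_sum N up_weight dn_weight site_den k s.
Proof.
elim: k s => [|k IH] s sN ks /=.
  rewrite big_seq1 /=; have := @stepE s n; rewrite /= -ks /= => ->.
  rewrite /up_weight -ks; case: eqP => sN'.
    by congr (q _); rewrite /n; case: sg1 => ->; lia.
  by apply: q_supp; rewrite /n; case: sg1 => ->; apply/eqP; lia.
rewrite big_cat /hop /=; congr (_ + _); case: ifP => h; rewrite ?big_nil //.
- rewrite big_map /= -IH //; last by rewrite /= -ks /= negbK.
  rewrite big_distrr /=; apply: eq_bigr => j _; congr (_ / _ * _).
  by rewrite -[s.+1]addn1 PoszD (step_up s).
case: s h sN ks => // s h sN ks.
rewrite big_map /= -IH //; [|exact: ltnW|by move: ks => /=; case: odd; case: odd].
rewrite big_distrr /= negbK; apply: eq_bigr => j _; congr (_ / _ * _).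
have -> : s%:Z = s.+1%:Z - 1 by lia.
exact: (step_dn s.+1).
Qed.

Lemma beta_summandE v :
  beta_summand p q n z v = walk_sum N up_weight dn_weight site_den v.*2 0.
Proof.
rewrite -sum_paths ?odd_double //; last exact: ltnW.
rewrite /beta_summand.
have F (j : (v.*2).-tuple int) :
    beta_numerator p q n j / \prod_(i <- j) (n%:~R - i%:~R + z) =
    tail_weight false n j.
  rewrite -tail_weightE /beta_numerator; congr (_ / _).
  by apply: eq_bigr => i _; rewrite addbF.
under eq_fsbigr do rewrite F.
rewrite -(@fsbig_image _ _ _ _ _ (@beta_indices n v.*2) val (tail_weight false n)); last first.
  by move=> x y _ _; exact: val_inj.
rewrite site0 (fsbig_seq _ _ (paths_uniq v.*2 0)).
symmetry; apply: fsbig_widen.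
  move=> j /= /(paths_good (ltnW N1)) [gj /eqP sj].
  by exists (Tuple sj).
move=> j [/= [jt gj <-]] jN; rewrite -site0.
apply: (@paths_complete jt 0 (ltnW N1)) => //; rewrite ?size_tuple ?odd_double //.
exact/negP.
Qed.

End PathExpansion.

(** * Closed forms of beta and of its leading term *)
Section ClosedForm.
Local Open Scope classical_set_scope.
Local Open Scope ring_scope.
Local Open Scope complex_scope.
Variable R : realType.
Variables p q : int -> R[i].
Hypothesis p_supp : forall k, k != 2 -> k != -2 -> p k = 0.
Hypothesis q_supp : forall k, k != 2 -> k != -2 -> q k = 0.
Variables (sg : int) (N : nat).
Hypothesis sg1 : sg = 1 \/ sg = -1.
Hypothesis oN : odd N.

Let n : int := sg * N%:Z.
Local Notation up := (up_weight p q sg).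
Local Notation dn := (dn_weight p q sg).

Lemma limn_geometric (u : nat -> R[i]^o) (l : R[i]) (S : R) :
  (forall V, normc (l - u V) <= S / 2 ^+ V) -> limn u = l.
Proof.
move=> ul; apply: cvg_lim; first exact: norm_hausdorff.
apply/cvgrPdist_lt => -[e e'] /=.
rewrite ltcE /= => /andP[/eqP -> e0].
have /cvgrPdist_lt /(_ _ e0) : (fun V => S * (2^-1) ^+ V) @ \oo --> (0 : R).
  rewrite -[X in _ --> X](mulr0 S); apply: cvgM; first exact: cvg_cst.
  by apply: cvg_expr; rewrite ger0_norm; lra.
case=> M _ H; exists M => // V MV /=.
rewrite complexr0 lt_cmod; apply: le_lt_trans (ul V) _.
have := H V MV; rewrite /= sub0r normrN exprVn.
exact: le_lt_trans (ler_norm _).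
Qed.

(** The walk series is the Neumann series of a tridiagonal system, whose solution
    is known from elimination. *)
Lemma beta_plusE (z : R[i]) (c : R) : let d := site_den sg N z in
  let e := pivot d (fun s => dn s.+1 * up s) in
  (1 < N)%N ->
  (forall s, normc (up s) <= c) -> (forall s, normc (dn s) <= c) ->
  (forall s, (0 < s < N)%N -> d s != 0) ->
  (forall s, (0 < s)%N -> (s.+1 < N)%N -> 8 * c ^+ 2 <= normc (d s) * normc (d s.+1)) ->
  beta_plus p q n z = (\prod_(0 <= i < N) up i) / \prod_(1 <= i < N) e i.
Proof.
move=> d e N1 up_c dn_c d0 d_large.
have e0 s : (0 < s < N)%N -> e s != 0.
  apply: pivot_neq0 => // t t0 tN; apply: le_trans (d_large t t0 tN).
  rewrite normc_mul; have : normc (dn t.+1) * normc (up t) <= c * c.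
    by rewrite ler_pM ?normc_ge0.
  have := sqr_ge0 c; rewrite expr2; lra.
have [S HS] := walk_sum_converges N1 d0 e0 up_c dn_c d_large oN.
have -> : (\prod_(0 <= i < N) up i) / (\prod_(1 <= i < N) e i) = up 0 * hit N up dn d 1.
  rewrite /hit prodf_div big_ltn ?mulrA //; exact: ltnW.
rewrite /beta_plus q_supp ?add0r; first last.
- by rewrite /n; apply/eqP; case: sg1 => ->; lia.
- by rewrite /n; apply/eqP; case: sg1 => ->; lia.
apply: (@limn_geometric _ _ S) => V.
suff -> : \sum_(1 <= v < V) beta_summand p q n z v =
    \sum_(v < V) walk_sum N up dn d v.*2 0 by exact: HS.
rewrite -(big_mkord predT (fun v => walk_sum N up dn d v.*2 0)).
case: V => [|V]; first by rewrite !big_geq.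
rewrite [RHS]big_ltn //= ifF ?add0r; last by lia.
by apply: eq_bigr => v _; rewrite beta_summandE.
Qed.

Lemma sum_nseq (k : nat) (c : int) : \sum_(t <- nseq k c) t = c * k%:Z.
Proof.
elim: k => [|k IH] /=; first by rewrite big_nil mulr0.
by rewrite big_cons IH intS; ring.
Qed.

Lemma vertex_nseq k : (k <= N)%N -> vertex n (nseq N (2 * sg)) k = sg * (2 * k%:Z - N%:Z).
Proof.
move=> kN; rewrite /vertex take_nseq // sum_nseq /n; ring.
Qed.

(** Without backward steps the walk is forced. *)
Lemma walks0 : walks n 0 = [set nseq N (2 * sg)].
Proof.
have N0 : (0 < N)%N by case: (N) oN.
apply/seteqP; split=> [x [[_ steps sumx _] /eqP]|_ ->] /=.
  rewrite eqn0Ngt -has_count -all_predC => back.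
  have /all_pred1P xE : all (pred1 (2 * sg)) x.
    apply/allP => t tx; move/allP/(_ t tx) in steps; move/allP/(_ t tx): back => /=.
    by case/orP: steps => /eqP ->; rewrite /n; case: sg1 => ->; case: ifP => //; lia.
  move: sumx; rewrite xE sum_nseq => h; congr nseq.
  by move: h; rewrite /n; case: sg1 => ->; lia.
split; last first.
  apply/eqP; rewrite eqn0Ngt -has_count -all_predC; apply/allP => t /nseqP[-> _] /=.
  by rewrite /n; case: sg1 => ->; case: ifP => //; lia.
split; rewrite ?size_nseq //.
- by apply/allP => t /nseqP[-> _]; case: sg1 => ->.
- by rewrite sum_nseq /n; ring.
move=> k kN; rewrite vertex_nseq; last by lia.
by rewrite /n; case: sg1 => ->; case: odd; lia.
Qed.

Lemma sigma_plus0E : sigma_plus p q 0 n 0 =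
  (\prod_(0 <= i < N) up i) / \prod_(1 <= i < N) site_den sg N 0 i.
Proof.
rewrite /sigma_plus walks0 fsbig_set1 /walk_weight size_nseq; congr (_ / _).
  rewrite big_mkord; apply: eq_bigr => t _; rewrite nth_nseq ltn_ord.
  by rewrite /up_weight.
apply: eq_big_nat => k kN; rewrite vertex_nseq; last by lia.
rewrite /site_den /site -/n /=; case: odd => //.
by rewrite -[LHS]addrA -[RHS]addrA; congr (_ + (_ + _)); rewrite -rmorphN /=; congr (_%:~R); ring.
Qed.

End ClosedForm.

(** * Harmonic sums *)
Section PairSums.
Variable F : numFieldType.

Lemma big_nat_pairs (T : Type) (idx : T) (op : Monoid.com_law idx) (f : nat -> T) m :
  \big[op/idx]_(1 <= s < 2 * m + 1) f s =
  \big[op/idx]_(i < m) op (f (2 * i + 1)%N) (f (2 * i + 2)%N).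
Proof.
elim: m => [|m IH]; first by rewrite big_geq // big_ord0.
have -> : (2 * m.+1 + 1)%N = (2 * m + 1).+2 by lia.
rewrite big_nat_recr; last by lia.
rewrite big_nat_recr /=; last by lia.
rewrite IH big_ord_recr /= Monoid.mulmA; congr (op _ (f _)); lia.
Qed.

Lemma sum_nat_pairs (f : nat -> F) m :
  \sum_(1 <= s < 2 * m) f s =
  \sum_(i < m) f (2 * i + 1)%N + \sum_(i < m.-1) f (2 * i + 2)%N.
Proof.
case: m => [|m]; first by rewrite big_geq // !big_ord0 addr0.
have -> : (2 * m.+1)%N = (2 * m + 1).+1 by lia.
rewrite big_nat_recr; last by lia.
by rewrite big_nat_pairs big_split big_ord_recr /= addrAC.
Qed.

Definition harmonic_sum m : F := \sum_(i < m) (i.+1%:R)^-1.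
Local Notation H := harmonic_sum.

Lemma harmonic_sum_rev m : \sum_(i < m) ((m - i)%N%:R)^-1 = H m.
Proof.
rewrite /H (reindex_inj rev_ord_inj) /=; apply: eq_bigr => i _.
by congr (_%:R)^-1; have := ltn_ord i; lia.
Qed.

(** Partial fractions: both resulting sums are harmonic. *)
Lemma sum_inv_mul m :
  \sum_(i < m) (16 * ((m - i)%N%:R * i.+1%:R))^-1 = H m / (8 * m.+1%:R) :> F.
Proof.
have E (i : 'I_m) : (16 * ((m - i)%N%:R * i.+1%:R))^-1 =
    (16 * m.+1%:R)^-1 * (((m - i)%N%:R)^-1 + (i.+1%:R)^-1) :> F.
  have im := ltn_ord i.
  have x0 : ((m - i)%N%:R : F) != 0 by rewrite pnatr_eq0; lia.
  have -> : (m.+1%:R : F) = (m - i)%N%:R + i.+1%:R by rewrite -natrD; congr _%:R; lia.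
  have y0 : (i.+1%:R : F) != 0 by rewrite pnatr_eq0.
  have xy0 : ((m - i)%N%:R + i.+1%:R : F) != 0 by rewrite -natrD pnatr_eq0; lia.
  move: x0 y0 xy0; move: (_%:R) (_%:R) => x y x0 y0 xy0.
  by field; rewrite ?x0 ?y0 xy0.
rewrite (eq_bigr _ (fun i _ => E i)) -big_distrr big_split /= harmonic_sum_rev -/(H m).
have m0 : (m.+1%:R : F) != 0 by rewrite pnatr_eq0.
by field.
Qed.

End PairSums.

Section HarmonicBounds.
Variable R : realType.
Local Notation H := (harmonic_sum R).

Lemma harmonic_sum_le m : (0 < m)%N -> H m <= 1 + ln m%:R.
Proof.
case: m => // m _; elim: m => [|m IH].
  by rewrite /H big_ord_recl big_ord0 addr0 ln1 invr1 addr0.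
have -> : H m.+2 = H m.+1 + (m.+2%:R)^-1 by rewrite /H big_ord_recr.
suff : (m.+2%:R)^-1 <= ln m.+2%:R - ln m.+1%:R :> R.
  by move: IH; move: (H _) (ln _) (ln _) (_^-1) => *; lra.
have x0 : 0 < m.+1%:R :> R by rewrite ltr0n.
have y0 : 0 < m.+2%:R :> R by rewrite ltr0n.
have e : m.+1%:R / m.+2%:R = 1 + - (m.+2%:R)^-1 :> R.
  by rewrite -[m.+2]addn1 natrD in y0 *; field; rewrite gt_eqF.
have : ln (m.+1%:R / m.+2%:R : R) <= - (m.+2%:R)^-1.
  rewrite e le_ln1Dx // ltrN2 invf_lt1 // ltr1n //.
by rewrite ln_div ?posrE //; move: (ln _) (ln _) (_^-1) => *; lra.
Qed.

Lemma ln_nat_ge1 m : (4 <= m)%N -> 1 <= ln m%:R :> R.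
Proof.
move=> m4; have : ln (2%:R^-1 : R) <= - 2^-1.
  rewrite [X in ln X](_ : _ = 1 + - 2^-1); last by lra.
  by rewrite le_ln1Dx //; lra.
rewrite lnV ?posrE // => h.
apply: (@le_trans _ _ (ln (2 ^+ 2 : R))).
  by rewrite lnXn // mulr2n; lra.
by rewrite ler_ln ?posrE ?ltr0n ?exprn_gt0 //; [rewrite -natrX ler_nat | lia].
Qed.

(** From [ln x = 2 ln (sqrt x) < 2 sqrt x]. *)
Lemma ln_over_nat_small (k : R) : 0 < k ->
  exists M : nat, forall m, (M <= m)%N -> ln m%:R / m%:R <= k.
Proof.
move=> k0; exists (Num.truncn (4 / k ^+ 2)).+1 => m Mm.
have m0 : 0 < m%:R :> R by rewrite ltr0n; lia.
have k2 : 0 < k ^+ 2 by rewrite exprn_gt0.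
have mk : 4 / k ^+ 2 <= m%:R.
  apply/ltW/(lt_le_trans (truncnS_gt _)).
  by rewrite ler_nat.
set r := Num.sqrt (m%:R : R).
have r0 : 0 < r by rewrite sqrtr_gt0.
have rr : r ^+ 2 = m%:R by rewrite sqr_sqrtr // ltW.
have lr : ln r < r by exact: ln_sublinear.
rewrite ler_pdivrMr // -rr lnXn // mulr2n.
have : 2 <= k * r.
  have kr0 : 0 < k * r by rewrite mulr_gt0.
  have : 4 <= (k * r) ^+ 2 by rewrite exprMn rr mulrC -ler_pdivrMr.
  rewrite expr2; move: (k * r) kr0 => u u0 u4; rewrite leNgt; apply/negP; nra.
nra.
Qed.

Lemma harmonic_sum_ge0 m : 0 <= H m.
Proof. by apply: sumr_ge0 => i _; rewrite invr_ge0. Qed.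

Lemma harmonic_sum_le2 m : (4 <= m)%N -> H m <= 2 * ln m%:R.
Proof.
move=> m4; have := ln_nat_ge1 m4; have := @harmonic_sum_le m ltac:(lia).
move: (H _) (ln _) => *; lra.
Qed.

End HarmonicBounds.

Section Gaps.

(** The modulus of the denominator at the site [s] when [z = 0]. Small gaps occur
    near [s = 0] at even sites and near [s = 2 m + 1] at odd ones. *)
Definition gap (m s : nat) : nat :=
  (if odd s then 2 * (2 * m + 1 - s) else 2 * s)%N.

Lemma gap_odd m i : gap m (2 * i + 1) = (4 * (m - i))%N.
Proof. by rewrite /gap ifT; lia. Qed.

Lemma gap_even m i : gap m (2 * i + 2) = (4 * i.+1)%N.
Proof. by rewrite /gap ifF; lia. Qed.

Lemma gap_ge4 m s : (0 < s < 2 * m + 1)%N -> (4 <= gap m s)%N.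
Proof. by rewrite /gap; case: ifP; lia. Qed.

(** A product [(i + 1) (k + 1)] is at least [i + k + 1]. *)
Lemma gap_mul_ge m s : (0 < s < 2 * m)%N -> (16 * m.-1 <= gap m s * gap m s.+1)%N.
Proof.
move=> sm; have [os|es] := boolP (odd s).
  have [i si] : exists i, s = (2 * i + 1)%N by exists s./2; lia.
  have -> : s.+1 = (2 * i + 2)%N by lia.
  rewrite si gap_odd gap_even.
  have [k mk] : exists k, (m - i)%N = k.+1 by exists (m - i).-1; lia.
  have -> : m = (i + k.+1)%N by lia.
  by rewrite addKn; nia.
have [i si] : exists i, s = (2 * i + 2)%N by exists s.-2./2; lia.
have -> : s.+1 = (2 * i.+1 + 1)%N by lia.
rewrite si gap_odd gap_even.
have [k mk] : exists k, (m - i.+1)%N = k.+1 by exists (m - i.+1).-1; lia.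
have -> : m = (i.+1 + k.+1)%N by lia.
by rewrite addKn /=; nia.
Qed.

Lemma sum_inv_gap (F : numFieldType) m :
  \sum_(1 <= s < 2 * m + 1) ((gap m s)%:R)^-1 = harmonic_sum F m / 2.
Proof.
rewrite big_nat_pairs.
rewrite (eq_bigr (fun i : 'I_m => 4^-1 * (((m - i)%N%:R)^-1 + (i.+1%:R)^-1))).
  2: by move=> i _; rewrite gap_odd gap_even !natrM !invfM mulrDr.
rewrite -big_distrr big_split /= harmonic_sum_rev -/(harmonic_sum F m).
by field.
Qed.

Lemma sum_inv_gap2 (F : numFieldType) m (x y : F) : (0 < m)%N ->
  \sum_(1 <= s < 2 * m) (if odd s then x else y) / ((gap m s)%:R * (gap m s.+1)%:R) =
  x * (harmonic_sum F m / (8 * m.+1%:R)) + y * (harmonic_sum F m.-1 / (8 * m%:R)).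
Proof.
move=> m0; rewrite sum_nat_pairs; congr (_ + _).
  rewrite -sum_inv_mul big_distrr /=; apply: eq_bigr => i _.
  have -> : (2 * i + 1).+1%N = (2 * i + 2)%N by lia.
  rewrite gap_odd gap_even ifT; last by lia.
  by congr (_ / _); rewrite !natrM; ring.
have := @sum_inv_mul F m.-1; rewrite prednK // => <-.
rewrite big_distrr /=; apply: eq_bigr => i _.
have -> : (2 * i + 2).+1%N = (2 * i.+1 + 1)%N by lia.
rewrite gap_odd gap_even ifF; last by lia.
congr (_ / _); rewrite !natrM.
have -> : (m.-1 - i = m - i.+1)%N by lia.
ring.
Qed.

End Gaps.

(** * The ratio of beta to its leading term *)
Section SignedSites.
Variable R : realType.
Variables (sg : int) (m : nat).
Hypothesis sg1 : sg = 1 \/ sg = -1.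
Let N := (2 * m + 1)%N.

Lemma sign_sqr : (sg%:~R : R[i]) * sg%:~R = 1.
Proof. by rewrite -rmorphM /=; case: sg1 => ->. Qed.

Lemma normc_sign : normc (sg%:~R : R[i]) = 1.
Proof.
by case: sg1 => ->; rewrite -?[(-1)%:~R]/(- (1 : R[i])) ?normc_opp normc_1.
Qed.

Lemma site_den_gap s (x : R[i]) : (s <= N)%N ->
  site_den sg N x s = sg%:~R * ((gap m s)%:R + sg%:~R * x).
Proof.
move=> sN; rewrite mulrDr mulrA sign_sqr mul1r /site_den; congr (_ + _).
rewrite -rmorphB /= -[(gap m s)%:R]/((gap m s)%:Z%:~R) -rmorphM /=; congr (_%:~R).
rewrite /site /gap /=; case: odd; rewrite /N in sN *; last by ring.
by case: sg1 => ->; lia.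
Qed.

End SignedSites.

Section BetaRatio.
Variable R : realType.
Variables p q : int -> R[i].
Hypothesis p_supp : forall k, k != 2 -> k != -2 -> p k = 0.
Hypothesis q_supp : forall k, k != 2 -> k != -2 -> q k = 0.
Variables (sg : int) (m : nat) (z : R[i]) (c : R).
Hypothesis sg1 : sg = 1 \/ sg = -1.
Hypothesis m2 : (2 <= m)%N.
Hypothesis p_le : forall k, normc (p k) <= c.
Hypothesis q_le : forall k, normc (q k) <= c.
Hypothesis c_m : 4 * c ^+ 2 <= m%:R.
Hypothesis z_le : normc z <= 1.

Let N := (2 * m + 1)%N.
Let zeta : R[i] := sg%:~R * z.
Local Notation up := (up_weight p q sg).
Local Notation dn := (dn_weight p q sg).
Local Notation d := (site_den sg N z).
Local Notation b := (gap m).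
Let g s := dn s.+1 * up s.
Local Notation e := (pivot d g).
Local Notation delta := (pivot_defect d g).

Let sgsg := sign_sqr R sg1.
Let normc_sg := normc_sign R sg1.
Let site_denE := fun s x => @site_den_gap R sg m sg1 s x.

Lemma normc_zeta : normc zeta = normc z.
Proof. by rewrite normc_mul normc_sg mul1r. Qed.

Lemma gap_pos s : (0 < s < N)%N -> 4 <= (b s)%:R :> R.
Proof. by move=> sN; rewrite (ler_nat _ 4); exact: gap_ge4. Qed.

Lemma gapC_neq0 s : (0 < s < N)%N -> (b s)%:R != 0 :> R[i].
Proof. by move=> sN; rewrite pnatr_eq0; have := gap_ge4 sN; lia. Qed.

Lemma d_ge s : (0 < s < N)%N -> (b s)%:R / 2 <= normc (d s).
Proof.
move=> sN; rewrite site_denE ?normc_mul ?normc_sg ?mul1r; last by case/andP: sN => _ /ltnW.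
rewrite -/zeta; have := ler_subnormc (b s)%:R (- zeta); rewrite opprK normc_opp normc_zeta.
rewrite normc_nat; move: z_le (gap_pos sN).
by move: ((b s)%:R : R) (normc z) (normc _) => *; lra.
Qed.

Lemma d_neq0 s : (0 < s < N)%N -> d s != 0.
Proof.
by move=> sN; rewrite -normc_gt0; move: (d_ge sN) (gap_pos sN); move: ((b s)%:R : R) (normc _) => *; lra.
Qed.

Lemma gap2_ge s : (0 < s)%N -> (s.+1 < N)%N -> 8 * m%:R <= (b s)%:R * (b s.+1)%:R :> R.
Proof.
move=> s0 sN; rewrite -!natrM ler_nat.
by have := @gap_mul_ge m s; rewrite /N in sN *; lia.
Qed.

Lemma d2_ge s : (0 < s)%N -> (s.+1 < N)%N ->
  (b s)%:R * (b s.+1)%:R / 4 <= normc (d s) * normc (d s.+1).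
Proof.
move=> s0 sN; have sN' : (0 < s < N)%N by lia.
have -> : (b s)%:R * (b s.+1)%:R / 4 = (b s)%:R / 2 * ((b s.+1)%:R / 2) :> R by field.
by apply: ler_pM; rewrite ?d_ge // divr_ge0.
Qed.

Lemma d2_large s : (0 < s)%N -> (s.+1 < N)%N ->
  8 * c ^+ 2 <= normc (d s) * normc (d s.+1).
Proof.
move=> s0 sN; apply: le_trans (d2_ge s0 sN); move: (gap2_ge s0 sN) c_m.
by move: ((b s)%:R * _ : R) (m%:R : R) (c ^+ 2) => *; lra.
Qed.

Lemma up_le s : normc (up s) <= c. Proof. by rewrite /up_weight; case: odd. Qed.
Lemma dn_le s : normc (dn s) <= c. Proof. by rewrite /dn_weight; case: odd. Qed.
Lemma g_le s : normc (g s) <= c ^+ 2.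
Proof. by rewrite normc_mul expr2 ler_pM ?normc_ge0 ?dn_le ?up_le. Qed.

Lemma g_small s : (0 < s)%N -> (s.+1 < N)%N ->
  4 * normc (g s) <= normc (d s) * normc (d s.+1).
Proof.
move=> s0 sN; apply: le_trans (d2_large s0 sN).
by have := g_le s; have := normc_ge0 (g s); lra.
Qed.

Lemma delta_le s : (0 < s)%N -> (s.+1 < N)%N ->
  normc (delta s.+1) <= 8 * c ^+ 2 / ((b s)%:R * (b s.+1)%:R).
Proof.
move=> s0 sN; apply: le_trans (pivot_defect_le d_neq0 g_small s0 sN) _.
have D0 : 0 < (b s)%:R * (b s.+1)%:R :> R.
  by rewrite -natrM ltr0n muln_gt0; have := @gap_ge4 m s; have := @gap_ge4 m s.+1; rewrite /N in sN; lia.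
move: D0 (d2_ge s0 sN) (g_le s) (normc_ge0 (g s)).
move: ((b s)%:R * _ : R) (normc (g s)) (normc (d s) * _) (c ^+ 2).
move=> D x M y D0 DM xy x0; rewrite ler_pdivlMr // mulrAC ler_pdivrMr; last by lra.
have : x * D <= y * D by rewrite ler_wpM2r // ltW.
have : y * (D / 4) <= y * M by rewrite ler_wpM2l //; lra.
lra.
Qed.

(* S is the linear term of the deviation of beta / sigma_0 from 1, t bounds the sum
   of the moduli of the individual deviations. *)
Let S := \sum_(1 <= s < N) - (zeta / (b s)%:R) + \sum_(1 <= s < N) delta s.
Let t := harmonic_sum R m * (normc z / 2 + 2 * c ^+ 2 / m%:R).

Lemma delta1 : delta 1 = 0. Proof. by []. Qed.

Lemma sum_deltaE (V : nmodType) (f : R[i] -> V) : f 0 = 0 ->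
  \sum_(1 <= s < N) f (delta s) = \sum_(1 <= s < 2 * m) f (delta s.+1).
Proof.
by move=> f0; rewrite big_ltn ?delta1 ?f0 ?add0r /N ?addn1 ?big_add1 //; lia.
Qed.

(** Both sums of [sum_inv_gap2] are at most half of the right-hand side. *)
Lemma sum_inv_gap2_le :
  \sum_(1 <= s < 2 * m) ((b s)%:R * (b s.+1)%:R)^-1 <= harmonic_sum R m / (4 * m%:R) :> R.
Proof.
have := @sum_inv_gap2 R m 1 1 ltac:(lia); rewrite !mul1r => h.
rewrite (eq_bigr (fun s => (if odd s then 1 else 1) / ((b s)%:R * (b s.+1)%:R))); last first.
  by move=> s _; case: ifP; rewrite mul1r.
rewrite h; have m0' : (0 < m)%N by lia.
have m0 : 0 < m%:R :> R by rewrite ltr0n.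
have H0 := harmonic_sum_ge0 R m.
have Hm : harmonic_sum R m.-1 <= harmonic_sum R m.
  have {2}-> : m = m.-1.+1 by lia.
  by rewrite /harmonic_sum big_ord_recr /= lerDl invr_ge0.
have -> : harmonic_sum R m / (4 * m%:R) =
   harmonic_sum R m / (8 * m%:R) + harmonic_sum R m / (8 * m%:R).
  by field; rewrite gt_eqF.
apply: lerD; last by rewrite ler_pM2r // invr_gt0 mulr_gt0.
rewrite ler_wpM2l // lef_pV2 ?posrE ?mulr_gt0 ?ltr0n //.
by rewrite ler_pM2l // ler_nat.
Qed.

Lemma sum_delta_le :
  \sum_(1 <= s < N) normc (delta s) <= harmonic_sum R m * (2 * c ^+ 2 / m%:R).
Proof.
rewrite (@sum_deltaE R normc) ?normc_0 //.
apply: (@le_trans _ _ (\sum_(1 <= s < 2 * m) 8 * c ^+ 2 * ((b s)%:R * (b s.+1)%:R)^-1)).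
  rewrite big_nat_cond [leRHS]big_nat_cond; apply: ler_sum => s /andP[sm _].
  by apply: delta_le; rewrite /N; lia.
rewrite -big_distrr /=; have m0 : 0 < m%:R :> R by rewrite ltr0n; lia.
apply: le_trans (ler_wpM2l _ sum_inv_gap2_le) _; first by have := sqr_ge0 c; lra.
by rewrite le_eqVlt; apply/orP; left; apply/eqP; field; rewrite gt_eqF.
Qed.

(** Both closed forms have the same numerator, so the ratio is the inverse of the
    product of the [1 + zeta / gap] and of the [1 - delta]. *)
Lemma beta_ratio : t <= 1 / 4 -> exists eps : R[i],
  beta_plus p q (sg * N%:Z) z = sigma_plus p q 0 (sg * N%:Z) 0 * (1 + eps) /\
  normc eps <= 2 * (normc S + t ^+ 2).
Proof.
move=> t4.
have oN : odd N by rewrite /N; lia.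
have N1 : (1 < N)%N by rewrite /N; lia.
rewrite (beta_plusE p_supp q_supp sg1 oN N1 up_le dn_le d_neq0 d2_large).
rewrite sigma_plus0E //.
pose r := map (pair false) (index_iota 1 N) ++ map (pair true) (index_iota 1 N).
pose F (x : bool * nat) : R[i] := if x.1 then delta x.2 else - (zeta / (b x.2)%:R).
have SE : \sum_(x <- r) F x = S by rewrite big_cat !big_map.
have t_le : \sum_(x <- r) normc (F x) <= t.
  rewrite big_cat !big_map /= /t mulrDr; apply: lerD; last exact: sum_delta_le.
  rewrite (eq_bigr (fun s => normc z * ((b s)%:R)^-1)); last first.
    by move=> s _; rewrite normc_opp normc_mul normc_inv normc_zeta normc_nat.
  by rewrite -big_distrr /= sum_inv_gap le_eqVlt; apply/orP; left; apply/eqP; field.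
have t0 : 0 <= \sum_(x <- r) normc (F x) by apply: sumr_ge0 => *; exact: normc_ge0.
have [P0 P_le] := @inv_prod_sub1 R _ r F (le_trans t_le t4).
exists ((\prod_(x <- r) (1 - F x))^-1 - 1); split; last first.
  apply: le_trans P_le _; rewrite SE ler_pM2l // lerD2l.
  by rewrite ler_pXn2r ?nnegrE //; apply: le_trans t_le.
rewrite addrC subrK.
have -> : \prod_(1 <= s < N) e s =
    (\prod_(1 <= s < N) site_den sg N 0 s) * \prod_(x <- r) (1 - F x).
  rewrite big_cat !big_map /= -!big_split /=.
  apply: eq_big_nat => s sN; rewrite (pivotE d_neq0 g_small sN) mulrA; congr (_ * _).
  have sN' : (s <= N)%N by case/andP: sN => _ /ltnW.
  rewrite !site_denE // -/zeta mulr0 addr0 opprK -mulrA; congr (_ * _).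
  by have := gapC_neq0 sN => b0; field.
by rewrite invfM mulrA.
Qed.

Lemma S_le_t : normc S <= t.
Proof.
apply: le_trans (ler_normcD _ _) _; rewrite /t mulrDr; apply: lerD.
  apply: le_trans (ler_normc_sum _ _) _.
  rewrite (eq_bigr (fun s => normc z * ((b s)%:R)^-1)); last first.
    by move=> s _; rewrite normc_opp normc_mul normc_inv normc_zeta normc_nat.
  by rewrite -big_distrr /= sum_inv_gap le_eqVlt; apply/orP; left; apply/eqP; field.
exact: le_trans (ler_normc_sum _ _) sum_delta_le.
Qed.

Let g1 := q (- (2 * sg)) * p (2 * sg).
Let g2 := p (- (2 * sg)) * q (2 * sg).

Lemma gE s : g s = if odd s then g1 else g2.
Proof. by rewrite /g /dn_weight /up_weight /=; case: odd. Qed.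

(** [delta] is [g / (gap * gap)] divided by three factors that are all close
    to 1. *)
Lemma delta_approx s : (0 < s)%N -> (s.+1 < N)%N ->
  normc z / 2 + c ^+ 2 / m%:R <= 1 / 4 ->
  normc (delta s.+1 - g s / ((b s)%:R * (b s.+1)%:R)) <=
  4 * c ^+ 2 * (normc z / 2 + c ^+ 2 / m%:R) * ((b s)%:R * (b s.+1)%:R)^-1.
Proof.
move=> s0 sN; set rho := _ + _ => rho4.
have m0 : 0 < m%:R :> R by rewrite ltr0n; lia.
have c20 : 0 <= c ^+ 2 by exact: sqr_ge0.
have s_in : (0 < s < N)%N by lia.
have delta_s : normc (delta s) <= c ^+ 2 / m%:R.
  case: s s0 sN {s_in} => // -[|s] _ sN; first by rewrite delta1 normc_0 divr_ge0 // ltW.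
  apply: le_trans (delta_le _ _) _ => //; first exact: ltnW.
  have D := @gap2_ge s.+1 isT (ltnW sN).
  rewrite ler_pdivrMr; last by apply: lt_le_trans D; rewrite mulr_gt0.
  have -> : 8 * c ^+ 2 = c ^+ 2 / m%:R * (8 * m%:R) by field; rewrite gt_eqF.
  by rewrite ler_wpM2l // divr_ge0 // ltW.
have zb x : (0 < x < N)%N -> normc (- (zeta / (b x)%:R)) <= normc z / 4.
  move=> xN; rewrite normc_opp normc_mul normc_inv normc_zeta normc_nat.
  rewrite ler_wpM2l ?normc_ge0 // lef_pV2 ?posrE //; first exact: gap_pos.
  exact: lt_le_trans (gap_pos xN).
pose r := [:: - (zeta / (b s)%:R); - (zeta / (b s.+1)%:R); delta s].
have r_le : \sum_(x <- r) normc x <= rho.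
  rewrite !big_cons big_nil addr0 /rho.
  have := zb _ s_in; have := zb s.+1 sN; move: delta_s.
  move: (normc _) (normc (- _)) (normc (- _)) (_ / m%:R) (normc z) => *; lra.
have r0 : 0 <= \sum_(x <- r) normc x by apply: sumr_ge0 => *; exact: normc_ge0.
have [P0 P_le] := @inv_prod_sub1 R _ r id (le_trans r_le rho4).
set P := \prod_(x <- r) _ in P0 P_le.
have PE : d s.+1 * e s = (b s)%:R * (b s.+1)%:R * P.
  rewrite (pivotE d_neq0 g_small s_in) !site_denE; [|by case/andP: s_in => _ /ltnW|exact: ltnW].
  rewrite /P !big_cons big_nil mulr1 -/zeta !opprK.
  have b0 := gapC_neq0 s_in; have b1 := @gapC_neq0 s.+1 sN.
  rewrite -[LHS]mul1r -{1}sgsg.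
  have sg0 : sg%:~R != 0 :> R[i] by rewrite -normc_gt0 normc_sg.
  have sg2 := sgsg.
  transitivity ((sg%:~R * sg%:~R) * (sg%:~R * sg%:~R) *
    (((b s.+1)%:R + zeta) * (((b s)%:R + zeta) * (1 - delta s)))); first by ring.
  by rewrite sgsg; field; apply/andP.
have -> : delta s.+1 = g s / (d s.+1 * e s).
  by rewrite /pivot_defect eqSS eqn0Ngt s0.
rewrite PE; move: (g_le s); move: (g s) => gs gs_le.
rewrite invfM mulrA -[X in _ - X]mulr1 -mulrBr !normc_mul normc_inv !normc_mul !normc_nat.
rewrite mulrAC; apply: ler_wpM2r; first by rewrite invr_ge0 mulr_ge0.
have -> : 4 * c ^+ 2 * rho = c ^+ 2 * (4 * rho) by ring.
apply: ler_pM; rewrite ?normc_ge0 //.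
apply: le_trans P_le _.
have : normc (\sum_(x <- r) x) <= \sum_(x <- r) normc x by exact: ler_normc_sum.
move: r0 r_le rho4; move: (normc _) (\sum_(x <- r) normc x) => u v v0 v_rho rho4' uv.
have : v ^+ 2 <= v by rewrite expr2 ler_piMl; lra.
lra.
Qed.

(** The two parts of [S] are close to [- zeta * H / 2] and to
    [(g1 + g2) * H / (8 m)], where [H] is the harmonic sum: they cancel when
    [zeta] is close to [(g1 + g2) / (4 m)]. *)
Lemma S_second_order (C2 W : R) :
  normc (zeta - (g1 + g2) / (4 * m%:R)) <= C2 / m%:R ^+ 2 ->
  normc z <= W / m%:R ->
  normc z / 2 + c ^+ 2 / m%:R <= 1 / 4 ->
  normc S <= harmonic_sum R m / m%:R ^+ 2 * (C2 / 2 + c ^+ 2 / 4 + c ^+ 2 * (W / 2 + c ^+ 2)).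
Proof.
set rho := normc z / 2 + _ => zC zW rho4.
have m0 : 0 < m%:R :> R by rewrite ltr0n; lia.
have mC0 : m%:R != 0 :> R[i] by rewrite pnatr_eq0; lia.
have mC1 : m.+1%:R != 0 :> R[i] by rewrite pnatr_eq0.
have c20 : 0 <= c ^+ 2 by exact: sqr_ge0.
have H1 : 1 <= harmonic_sum R m.
  rewrite /harmonic_sum; case: (m) m2 => // k _.
  by rewrite big_ord_recl invr1 lerDl sumr_ge0 // => *; rewrite invr_ge0.
have H_C : harmonic_sum R[i] m = (harmonic_sum R m)%:C.
  rewrite /harmonic_sum rmorph_sum; apply: eq_bigr => i _.
  by rewrite fmorphV rmorph_nat.
have H_pred : harmonic_sum R[i] m.-1 = harmonic_sum R[i] m - (m%:R)^-1.
  have {2 3}-> : m = m.-1.+1 by rewrite prednK // ltnW.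
  by rewrite /harmonic_sum big_ord_recr /= addrK.
pose Err := \sum_(1 <= s < 2 * m) (delta s.+1 - g s / ((b s)%:R * (b s.+1)%:R)).
have Err_le : normc Err <= c ^+ 2 * rho * harmonic_sum R m / m%:R.
  apply: le_trans (ler_normc_sum _ _) _.
  apply: (@le_trans _ _ (\sum_(1 <= s < 2 * m) 4 * c ^+ 2 * rho * ((b s)%:R * (b s.+1)%:R)^-1)).
    rewrite big_nat_cond [leRHS]big_nat_cond; apply: ler_sum => s /andP[sm _].
    by apply: delta_approx => //; rewrite /N; clear -sm; lia.
  rewrite -big_distrr /=.
  have rho0 : 0 <= rho by rewrite addr_ge0 // divr_ge0 ?normc_ge0.
  apply: le_trans (ler_wpM2l _ sum_inv_gap2_le) _; first by rewrite mulr_ge0 // mulr_ge0.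
  by rewrite le_eqVlt; apply/orP; left; apply/eqP; field; rewrite gt_eqF.
have SE : S = - ((zeta - (g1 + g2) / (4 * m%:R)) * (harmonic_sum R[i] m / 2))
    - g1 * harmonic_sum R[i] m / (8 * (m%:R * m.+1%:R)) - g2 / (8 * (m%:R * m%:R)) + Err.
  rewrite /S (@sum_deltaE R[i] id) // /Err sumrB.
  have -> : \sum_(1 <= s < 2 * m) g s / ((b s)%:R * (b s.+1)%:R) =
      \sum_(1 <= s < 2 * m) (if odd s then g1 else g2) / ((b s)%:R * (b s.+1)%:R).
    by apply: eq_bigr => s _; rewrite gE.
  rewrite sum_inv_gap2; last exact: ltnW.
  rewrite sumrN -big_distrr /= sum_inv_gap H_pred -[m.+1]addn1 natrD.
  rewrite -[m.+1]addn1 natrD in mC1.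
  move: (harmonic_sum _ _) (\sum_(1 <= s < 2 * m) _) => H D.
  by field; rewrite mC0 mC1.
have g1_le : normc g1 <= c ^+ 2 by rewrite normc_mul expr2 ler_pM ?normc_ge0.
have g2_le : normc g2 <= c ^+ 2 by rewrite normc_mul expr2 ler_pM ?normc_ge0.
have H_norm : normc (harmonic_sum R[i] m) = harmonic_sum R m.
  by rewrite H_C normc_real ger0_norm // harmonic_sum_ge0.
have rho_le : rho <= (W / 2 + c ^+ 2) / m%:R.
  by rewrite /rho mulrDl lerD2r mulrAC ler_wpM2r.
rewrite SE; apply: le_trans (ler_normcD _ _) _.
apply: le_trans (lerD (ler_normcB _ _) (lexx _)) _.
apply: le_trans (lerD (lerD (ler_normcB _ _) (lexx _)) (lexx _)) _.
rewrite normc_opp [normc (_ * (_ / 2))]normc_mul.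
rewrite [normc (g1 * _ / _)]normc_mul normc_inv [normc (g1 * _)]normc_mul.
rewrite [normc (g2 / _)]normc_mul normc_inv [normc (_ / 2)]normc_mul normc_inv.
rewrite H_norm !(normc_mul 8) !(normc_mul m%:R) !normc_nat.
set H := harmonic_sum R m in H1 Err_le *; set M := m%:R in m0 zC Err_le rho_le *.
have M2 : 0 < M ^+ 2 by rewrite exprn_gt0.
have T1 : normc (zeta - (g1 + g2) / (4 * m%:R)) * (H / 2) <= H / M ^+ 2 * (C2 / 2).
  have -> : H / M ^+ 2 * (C2 / 2) = C2 / M ^+ 2 * (H / 2) by ring.
  by rewrite ler_wpM2r // divr_ge0 //; lra.
have H0 : 0 <= H by lra.
have T2 : normc g1 * H / (8 * (M * m.+1%:R)) <= H / M ^+ 2 * (c ^+ 2 / 8).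
  have -> : H / M ^+ 2 * (c ^+ 2 / 8) = c ^+ 2 * H / (8 * (M * M)).
    by field; rewrite gt_eqF.
  have lV : (8 * (M * m.+1%:R))^-1 <= (8 * (M * M))^-1.
    by rewrite lef_pV2 ?posrE ?mulr_gt0 // !ler_pM2l // /M ler_nat.
  apply: ler_pM lV; last by rewrite ler_wpM2r.
    by rewrite mulr_ge0 ?normc_ge0.
  by rewrite invr_ge0 !mulr_ge0 // ltW.
have T3 : normc g2 / (8 * (M * M)) <= H / M ^+ 2 * (c ^+ 2 / 8).
  have -> : H / M ^+ 2 * (c ^+ 2 / 8) = H * c ^+ 2 / (8 * (M * M)).
    by field; rewrite gt_eqF.
  apply: ler_wpM2r; first by rewrite invr_ge0 !mulr_ge0 // ltW.
  by apply: le_trans g2_le _; rewrite ler_peMl.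
have T4 : normc Err <= H / M ^+ 2 * (c ^+ 2 * (W / 2 + c ^+ 2)).
  apply: le_trans Err_le _.
  have -> : H / M ^+ 2 * (c ^+ 2 * (W / 2 + c ^+ 2)) =
    c ^+ 2 * ((W / 2 + c ^+ 2) / M) * H / M by field; rewrite gt_eqF.
  apply: ler_wpM2r; first by rewrite invr_ge0 ltW.
  by rewrite ler_wpM2r // ler_wpM2l.
have -> : H / M ^+ 2 * (C2 / 2 + c ^+ 2 / 4 + c ^+ 2 * (W / 2 + c ^+ 2)) =
  H / M ^+ 2 * (C2 / 2) + H / M ^+ 2 * (c ^+ 2 / 8) + H / M ^+ 2 * (c ^+ 2 / 8)
  + H / M ^+ 2 * (c ^+ 2 * (W / 2 + c ^+ 2)) by field; rewrite gt_eqF.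
by rewrite !lerD.
Qed.

Lemma beta_first_order : t <= 1 / 4 -> exists eps : R[i],
  beta_plus p q (sg * N%:Z) z = sigma_plus p q 0 (sg * N%:Z) 0 * (1 + eps) /\
  normc eps <= 4 * t.
Proof.
move=> t4; have [eps [betaE eps_le]] := beta_ratio t4; exists eps; split=> //.
have t0 : 0 <= t by exact: le_trans (normc_ge0 _) S_le_t.
apply: le_trans eps_le _; have : t ^+ 2 <= t by rewrite expr2 ler_piMl //; lra.
have := S_le_t; lra.
Qed.

Lemma beta_second_order (C2 W : R) :
  normc (zeta - (g1 + g2) / (4 * m%:R)) <= C2 / m%:R ^+ 2 ->
  normc z <= W / m%:R ->
  normc z / 2 + c ^+ 2 / m%:R <= 1 / 4 -> t <= 1 / 4 -> exists eps : R[i],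
  beta_plus p q (sg * N%:Z) z = sigma_plus p q 0 (sg * N%:Z) 0 * (1 + eps) /\
  normc eps <= 2 * (harmonic_sum R m / m%:R ^+ 2 *
    (C2 / 2 + c ^+ 2 / 4 + c ^+ 2 * (W / 2 + c ^+ 2)) + t ^+ 2).
Proof.
move=> zC zW rho4 t4; have [eps [betaE eps_le]] := beta_ratio t4; exists eps; split=> //.
by apply: le_trans eps_le _; rewrite ler_pM2l // lerD2r; exact: S_second_order.
Qed.

End BetaRatio.

(** * Complex-valued functions of a real variable *)
Section ComplexCalculus.
Variable R : realType.
Local Open Scope classical_set_scope.
Local Open Scope ring_scope.
Local Open Scope complex_scope.
Implicit Types (f g df dg : R -> R[i]) (x y : R) (w z : R[i]).
Local Notation Re := (@complex.Re R).
Local Notation Im := (@complex.Im R).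

Lemma ReD w z : Re (w + z) = Re w + Re z. Proof. by case: w z => ? ? []. Qed.
Lemma ImD w z : Im (w + z) = Im w + Im z. Proof. by case: w z => ? ? []. Qed.
Lemma ReB w z : Re (w - z) = Re w - Re z. Proof. by case: w z => ? ? []. Qed.
Lemma ImB w z : Im (w - z) = Im w - Im z. Proof. by case: w z => ? ? []. Qed.
Lemma ReM w z : Re (w * z) = Re w * Re z - Im w * Im z.
Proof. by case: w z => ? ? []. Qed.
Lemma ImM w z : Im (w * z) = Re w * Im z + Im w * Re z.
Proof. by case: w z => ? ? []. Qed.

Lemma normc_ge_absRe w : `|Re w| <= normc w.
Proof.
case: w => u v /=; rewrite -sqrtr_sqr ler_wsqrtr // lerDl; exact: sqr_ge0.
Qed.

Lemma normc_ge_absIm w : `|Im w| <= normc w.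
Proof.
case: w => u v /=; rewrite -sqrtr_sqr ler_wsqrtr // lerDr; exact: sqr_ge0.
Qed.

Lemma normc_le_Re_Im w : normc w <= `|Re w| + `|Im w|.
Proof.
have -> : w = (Re w)%:C + 'i * (Im w)%:C by exact: complexE.
rewrite ReD ImD; apply: le_trans (ler_normcD _ _) _.
rewrite normc_mul !normc_real; case: w => u v /=.
rewrite !(mul0r, mulr0, mul1r, subr0, add0r, addr0, expr0n, expr1n) /=.
by rewrite ?add0r ?sqrtr1 ?mul1r.
Qed.

Definition continuous_on_C x0 x1 f :=
  {within `[x0, x1], continuous (Re \o f)} /\ {within `[x0, x1], continuous (Im \o f)}.

(** Continuity up to the end points and a derivative inside: what an eigenfunction
    satisfies and the mean value inequality requires. *)
Definition C1_on x0 x1 f df :=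
  continuous_on_C x0 x1 f /\ (forall x, x \in `]x0, x1[ -> is_cderive f x (df x)).

Lemma within_continuous_lip (A : set R) f (h : R[i] -> R) :
  (forall w z, `|h w - h z| <= normc (w - z)) ->
  {within A, continuous (f : R -> R[i]^o)} -> {within A, continuous (h \o f)}.
Proof.
move=> h_lip cf x; apply/cvgrPdist_lt => e e0.
have e0' : 0 < e%:C :> R[i] by rewrite ltcR.
have /cvgrPdist_lt /(_ _ e0') := cf x.
apply: filterS => y fxy; apply: le_lt_trans (h_lip _ _) _.
by rewrite -lt_cmod; exact: fxy.
Qed.

Lemma continuous_on_CP x0 x1 f :
  {within `[x0, x1], continuous (f : R -> R[i]^o)} -> continuous_on_C x0 x1 f.
Proof.
move=> cf; split; apply: within_continuous_lip cf => w z.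
  by rewrite -ReB normc_ge_absRe.
by rewrite -ImB normc_ge_absIm.
Qed.

Lemma is_cderiveD f g x (df dg : R[i]) : is_cderive f x df -> is_cderive g x dg ->
  is_cderive (fun t => f t + g t) x (df + dg).
Proof.
move=> [f1 f2] [g1 g2]; split; rewrite ?ReD ?ImD.
  rewrite (_ : (fun t => _) = (Re \o f) + (Re \o g)); first exact: is_deriveD.
  by apply/funext => t; rewrite /= ReD.
rewrite (_ : (fun t => _) = (Im \o f) + (Im \o g)); first exact: is_deriveD.
by apply/funext => t; rewrite /= ImD.
Qed.

Lemma is_cderiveM f g x (df dg : R[i]) : is_cderive f x df -> is_cderive g x dg ->
  is_cderive (fun t => f t * g t) x (df * g x + f x * dg).
Proof.
move=> [f1 f2] [g1 g2]; split.
  rewrite (_ : (fun t => _) = (Re \o f) * (Re \o g) - (Im \o f) * (Im \o g)).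
    apply: (is_derive_eq (is_deriveB (is_deriveM f1 g1) (is_deriveM f2 g2))).
    by rewrite ReD !ReM /GRing.scale /=; ring.
  by apply/funext => t; rewrite /= ReM.
rewrite (_ : (fun t => _) = (Re \o f) * (Im \o g) + (Im \o f) * (Re \o g)).
  apply: (is_derive_eq (is_deriveD (is_deriveM f1 g2) (is_deriveM f2 g1))).
  by rewrite ImD !ImM /GRing.scale /=; ring.
by apply/funext => t; rewrite /= ImM.
Qed.

Lemma C1_onD x0 x1 f g df dg : C1_on x0 x1 f df -> C1_on x0 x1 g dg ->
  C1_on x0 x1 (fun t => f t + g t) (fun t => df t + dg t).
Proof.
move=> [[f1 f2] fd] [[g1 g2] gd]; split; last by move=> x xI; apply: is_cderiveD; auto.
split=> x.
- rewrite (_ : _ \o _ = fun t => Re (f t) + Re (g t)).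
    by apply: cvgD; [exact: f1|exact: g1].
  by apply/funext => t; rewrite /= ReD.
- rewrite (_ : _ \o _ = fun t => Im (f t) + Im (g t)).
    by apply: cvgD; [exact: f2|exact: g2].
  by apply/funext => t; rewrite /= ImD.
Qed.

Lemma C1_onM x0 x1 f g df dg : C1_on x0 x1 f df -> C1_on x0 x1 g dg ->
  C1_on x0 x1 (fun t => f t * g t) (fun t => df t * g t + f t * dg t).
Proof.
move=> [[f1 f2] fd] [[g1 g2] gd]; split; last by move=> x xI; apply: is_cderiveM; auto.
split=> x.
- rewrite (_ : _ \o _ = fun t => Re (f t) * Re (g t) - Im (f t) * Im (g t)).
    apply: cvgB; apply: cvgM; [exact: f1|exact: g1|exact: f2|exact: g2].
  by apply/funext => t; rewrite /= ReM.
- rewrite (_ : _ \o _ = fun t => Re (f t) * Im (g t) + Im (f t) * Re (g t)).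
    apply: cvgD; apply: cvgM; [exact: f1|exact: g2|exact: f2|exact: g1].
  by apply/funext => t; rewrite /= ImM.
Qed.

Lemma is_cderive_C1_on x0 x1 f df : (forall x, is_cderive f x (df x)) -> C1_on x0 x1 f df.
Proof.
move=> fd; split=> //; split; apply: derivable_within_continuous => x _.
  by have [[]] := fd x.
by have [_ []] := fd x.
Qed.

Lemma C1_on_cst x0 x1 w : C1_on x0 x1 (fun=> w) (fun=> 0).
Proof. by apply: is_cderive_C1_on => x; split; exact: is_derive_cst. Qed.

(** The function [x |-> e ^ (w x)]. *)
Definition cexp w x : R[i] :=
  (expR (Re w * x) * cos (Im w * x)) +i* (expR (Re w * x) * sin (Im w * x)).

Lemma cexpD w z x : cexp (w + z) x = cexp w x * cexp z x.
Proof.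
apply/eqP; rewrite eq_complex /cexp ReM ImM /= ReD ImD !mulrDl expRD cosD sinD.
by apply/andP; split; apply/eqP; ring.
Qed.

Lemma cexp0r w : cexp w 0 = 1.
Proof. by rewrite /cexp !mulr0 expR0 cos0 sin0 mul1r mulr0. Qed.

Lemma cexp0l x : cexp 0 x = 1.
Proof. by rewrite /cexp /= !mul0r expR0 cos0 sin0 mul1r mulr0. Qed.

Lemma cexpNK w x : cexp (- w) x * cexp w x = 1.
Proof. by rewrite -cexpD addNr cexp0l. Qed.

Lemma normc_cexp w x : normc (cexp w x) = expR (Re w * x).
Proof.
by rewrite /= !exprMn -mulrDr cos2Dsin2 mulr1 sqrtr_sqr ger0_norm // expR_ge0.
Qed.

Lemma is_cderive_cexp w x : is_cderive (cexp w) x (w * cexp w x).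
Proof.
have lin k : is_derive x 1 (fun t : R => k * t) k.
  have -> : (fun t : R => k * t) = k \*: id by [].
  by apply: is_derive_eq; rewrite /GRing.scale /= mulr1.
have e1 : is_derive x 1 (expR \o (fun t => Re w * t)) (expR (Re w * x) * Re w).
  exact: is_derive1_comp.
have c1 : is_derive x 1 (cos \o (fun t => Im w * t)) (- sin (Im w * x) * Im w).
  exact: is_derive1_comp.
have s1 : is_derive x 1 (sin \o (fun t => Im w * t)) (cos (Im w * x) * Im w).
  exact: is_derive1_comp.
split.
  rewrite (_ : (fun t => _) = (expR \o (fun t => Re w * t)) * (cos \o (fun t => Im w * t))) //.
  by apply: is_derive_eq; rewrite ReM /GRing.scale /=; ring.
rewrite (_ : (fun t => _) = (expR \o (fun t => Re w * t)) * (sin \o (fun t => Im w * t))) //.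
by apply: is_derive_eq; rewrite ImM /GRing.scale /=; ring.
Qed.

Lemma C1_on_cexp x0 x1 w : C1_on x0 x1 (cexp w) (fun x => w * cexp w x).
Proof. by apply: is_cderive_C1_on => x; exact: is_cderive_cexp. Qed.

(** The factor 2 comes from treating real and imaginary parts separately. *)
Lemma mean_value_ineq x0 x1 f df (M : R) : C1_on x0 x1 f df ->
  (forall x, x \in `]x0, x1[ -> normc (df x) <= M) ->
  forall x, x \in `[x0, x1] -> normc (f x - f x0) <= 2 * M * (x - x0).
Proof.
move=> [[f1 f2] fd] dfM x; rewrite in_itv /= => /andP[x0x xx1].
have sub y : y \in `]x0, x[ -> y \in `]x0, x1[.
  by rewrite !in_itv /= => /andP[-> yx] /=; exact: lt_le_trans xx1.
have cont (h : R -> R) : {within `[x0, x1], continuous h} -> {within `[x0, x], continuous h}.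
  apply: continuous_subspaceW => y /=; rewrite !in_itv /= => /andP[-> yx] /=.
  exact: le_trans xx1.
move: x0x; rewrite le_eqVlt => /predU1P[->|x0x].
  by rewrite !subrr normc_0 mulr0.
have [c1 c1I e1] := @MVT _ (Re \o f) (fun y => Re (df y)) x0 x x0x
   (fun y yI => (fd y (sub y yI)).1) (cont _ f1).
have [c2 c2I e2] := @MVT _ (Im \o f) (fun y => Im (df y)) x0 x x0x
   (fun y yI => (fd y (sub y yI)).2) (cont _ f2).
apply: le_trans (normc_le_Re_Im _) _; rewrite ReB ImB.
rewrite /= in e1 e2; rewrite e1 e2 !normrM (gtr0_norm (x:=x - x0)) ?subr_gt0 //.
rewrite -mulrDl ler_pM2r ?subr_gt0 // mulr2n mulrDl mul1r.
by apply: lerD; [apply: le_trans (normc_ge_absRe _) _|apply: le_trans (normc_ge_absIm _) _];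
  apply: dfM; exact: sub.
Qed.

End ComplexCalculus.

(** * Lower bounds for the distance of an exponential to 1 *)
Section CexpLowerBound.
Local Open Scope classical_set_scope.
Local Open Scope ring_scope.
Local Open Scope complex_scope.
Variable R : realType.
Local Notation Re := (@complex.Re R).
Local Notation Im := (@complex.Im R).

Lemma pi_le4 : pi <= 4 :> R.
Proof. by have := @pihalf_lt2 R; lra. Qed.

Lemma sin_lower : exists2 k : R, 0 < k <= 1 &
  forall u, `|u| <= 3 * pi / 8 -> k * `|u| <= `|sin u|.
Proof.
have pi0 := @pi_gt0 R.
pose k : R := cos (3 * pi / 8); have k1 : k <= 1 by exact: cos_le1.
have k0 : 0 < k by apply: cos_gt0_pihalf; apply/andP; split; lra.
exists k; first by rewrite k0.
have H u : 0 <= u -> u <= 3 * pi / 8 -> k * u <= sin u.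
  have cs : {within `[0, u], continuous (@sin R)}.
    exact/continuous_subspaceT/continuous_sin.
  move=> u0 u1; have [x xI] := MVT_segment u0 (fun x _ => is_derive_sin x) cs.
  rewrite sin0 !subr0 => ->; apply: ler_wpM2r => //.
  move: xI; rewrite in_itv /= => /andP[x0 xu].
  rewrite leNgt ltr_cos ?in_itv /= -?leNgt; lra.
move=> u; case: (ger0P u) => [u0 u1|u0 u1].
  by apply: le_trans (ler_norm _); exact: H.
rewrite -normrN -sinN; apply: le_trans (ler_norm _); apply: H; lra.
Qed.

Lemma expR_sub1_lower (s : R) : `|s| <= 3 -> expR (- 3) * `|s| <= `|expR s - 1|.
Proof.
have e0 := expR_gt0 (-3 : R); have e1 : expR (-3 : R) <= 1 by rewrite -[leRHS]expR0 ler_expR; lra.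
case: (ger0P s) => s0 s3.
  rewrite ger0_norm; last by rewrite subr_ge0 -[leLHS]expR0 ler_expR.
  by have := expR_ge1Dx s; nra.
have e2 : expR s < 1 by rewrite -[ltRHS]expR0 ltr_expR.
rewrite ltr0_norm ?subr_lt0 //.
have h1 : expR (-3) <= expR s by rewrite ler_expR; lra.
have h2 := expR_ge1Dx (- s).
have h3 : expR s * expR (- s) = 1 by rewrite -expRD subrr expR0.
have : expR s * (1 - s) <= 1 by rewrite -h3 ler_wpM2l //; lra.
nra.
Qed.

(** If [i w pi = s + i t] then [|e ^ (i w pi) - 1| ^ 2] is
    [(e ^ s - 1) ^ 2 + 4 e ^ s (sin (t / 2)) ^ 2], and [|t / 2|] stays away from
    [pi / 2], hence from the first nonzero root of the sine. *)
Lemma cexp_pi_sub1_lower : exists2 k : R, 0 < k &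
  forall w : R[i], normc w <= 3 / 4 -> k * normc w <= normc (cexp ('i * w) pi - 1).
Proof.
have [k1 /andP[k10 k11] sin_ge] := sin_lower.
have e0 := expR_gt0 (-3 : R); have e1 : expR (-3 : R) <= 1 by rewrite -[leRHS]expR0 ler_expR; lra.
have pi0 := @pi_gt0 R; have pi2 := @pi_ge2 R; have pi4 := pi_le4.
exists (expR (-3) * k1); first by rewrite mulr_gt0.
move=> w w34.
pose s := - Im w * pi; pose t := Re w * pi.
have im_w := normc_ge_absIm w; have re_w := normc_ge_absRe w.
have s_le : `|s| <= 3 by rewrite normrM normrN (gtr0_norm pi0); nra.
have t_le : `|t / 2| <= 3 * pi / 8.
  rewrite !normrM (gtr0_norm pi0) [ `|2^-1|]gtr0_norm ?invr_gt0 //; nra.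
set L := normc (_ - _); have L0 : 0 <= L := normc_ge0 _.
have LE : L ^+ 2 = (expR s - 1) ^+ 2 + 4 * expR s * sin (t / 2) ^+ 2.
  rewrite /L; have -> : cexp ('i * w) pi - 1 = (expR s * cos t - 1) +i* (expR s * sin t).
    rewrite /cexp ReM ImM /= !(mul0r, mul1r, add0r, sub0r, addr0) -/s -/t.
    by apply/eqP; rewrite eq_complex /= oppr0 addr0 !eqxx.
  rewrite /= sqr_sqrtr ?addr_ge0 ?sqr_ge0 //.
  have tE : t = (t / 2) *+ 2 by rewrite mulr2n -mulrDr; field.
  rewrite {1 2}tE cos_mulr2n sin_mulr2n.
  have := cos2Dsin2 (t / 2); move: (cos _) (sin _) (expR s) => x y e cs.
  have -> : x ^+ 2 = 1 - y ^+ 2 by rewrite -cs addrK.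
  transitivity ((e * (1 - 2 * y ^+ 2) - 1) ^+ 2 + e ^+ 2 * 4 * (x ^+ 2) * y ^+ 2).
    by ring.
  have -> : x ^+ 2 = 1 - y ^+ 2 by rewrite -cs addrK.
  by ring.
have e_s : expR (-3) <= expR s by rewrite ler_expR; move: s_le; rewrite ler_norml; lra.
have Ls : expR (-3) * `|s| <= L.
  apply: le_trans (expR_sub1_lower s_le) _.
  rewrite -(@ler_pXn2r _ 2) ?nnegrE // -normrX ger0_norm ?sqr_ge0 // LE lerDl.
  by rewrite mulr_ge0 ?sqr_ge0 // mulr_ge0 ?expR_ge0.
have Lt : expR (-3) * k1 * `|t| <= L.
  rewrite -(@ler_pXn2r _ 2) ?nnegrE ?mulr_ge0 ?expR_ge0 ?(ltW k10) // LE.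
  have sin_t := sin_ge _ t_le.
  have sin2 : (k1 * `|t / 2|) ^+ 2 <= sin (t / 2) ^+ 2.
    rewrite -[leRHS]ger0_norm ?sqr_ge0 // normrX ler_pXn2r ?nnegrE //.
    by rewrite mulr_ge0 // ltW.
  apply: (@le_trans _ _ (4 * expR s * (k1 * `|t / 2|) ^+ 2)); last first.
    apply: (@le_trans _ _ (4 * expR s * sin (t / 2) ^+ 2)).
      by rewrite ler_wpM2l // mulr_ge0 ?expR_ge0.
    by rewrite lerDr sqr_ge0.
  have -> : `|t / 2| = `|t| / 2 by rewrite [LHS]normrM [X in _ * X]gtr0_norm ?invr_gt0.
  have -> : 4 * expR s * (k1 * (`|t| / 2)) ^+ 2 = expR s * (k1 * `|t|) ^+ 2 by field.
  rewrite -mulrA exprMn ler_wpM2r ?sqr_ge0 //.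
  by apply: le_trans e_s; rewrite expr2 ler_piMl // ltW.
have w_le : normc w * pi <= `|s| + `|t|.
  rewrite /s /t !normrM normrN (gtr0_norm pi0) -mulrDl ler_pM2r // addrC.
  exact: normc_le_Re_Im.
have st : expR (-3) * k1 * (`|s| + `|t|) <= L + L.
  rewrite mulrDr lerD //; apply: le_trans Ls.
  by rewrite ler_wpM2r // ler_piMr // ltW.
have ek : 0 < expR (-3) * k1 by rewrite mulr_gt0.
have w0 := normc_ge0 w.
have : expR (-3) * k1 * (normc w * 2) <= expR (-3) * k1 * (`|s| + `|t|).
  apply: ler_wpM2l; first exact: ltW.
  by apply: le_trans w_le; rewrite ler_wpM2l.
rewrite mulrA => h; have := le_trans h st; lra.
Qed.
End CexpLowerBound.

(** * Averaging the Dirac system *)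
Section Constants.
Variable R : realType.

(** The constants of [corr_le], [rem_le] and [component_estimate]. *)
Definition corr_const (c : R) := 2 * c + c ^+ 2 + 2 * c ^+ 3.
Definition rem_const (c : R) := 2 * c ^+ 2 * corr_const c + 8 * c ^+ 3 + 4 * c ^+ 4.
Definition component_const (c k0 : R) :=
  expR 4 * (1 + 8 * expR 4 * rem_const c) + corr_const c +
  8 * expR 4 * rem_const c / k0.

Lemma component_const_ge1 (c k0 : R) : 0 <= c -> 0 < k0 -> 1 <= component_const c k0.
Proof.
move=> c0 k00; have E := expR_ge0 (4 : R).
have C0 : 0 <= corr_const c by rewrite !addr_ge0 ?mulr_ge0 ?exprn_ge0.
have R0 : 0 <= rem_const c.
  by rewrite !addr_ge0 ?mulr_ge0 ?exprn_ge0.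
have F0 : 0 <= 8 * expR 4 * rem_const c by rewrite !mulr_ge0.
rewrite /component_const -[leLHS]addr0 -addrA lerD //; last by rewrite addr_ge0 // divr_ge0 // ltW.
rewrite mulrDr mulr1; apply: (@le_trans _ _ (expR 4)).
  by apply: le_trans (expR_ge1Dx _); lra.
by rewrite lerDl mulr_ge0.
Qed.

End Constants.

Section NormalForm.
Variable R : realType.
Local Open Scope classical_set_scope.
Local Open Scope ring_scope.
Local Open Scope complex_scope.
Local Notation Re := (@complex.Re R).
Local Notation Im := (@complex.Im R).

Lemma C1_on_eq x0 x1 (f df df' : R -> R[i]) : (forall x, df x = df' x) ->
  C1_on x0 x1 f df -> C1_on x0 x1 f df'.
Proof. by move=> /funext ->. Qed.

Definition trig (c1 c2 k : R[i]) (x : R) := c1 * cexp (- k) x + c2 * cexp k x.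

Lemma C1_on_trig x0 x1 (c1 c2 k : R[i]) :
  C1_on x0 x1 (trig c1 c2 k) (trig (- k * c1) (k * c2) k).
Proof.
apply: C1_on_eq (C1_onD (C1_onM (C1_on_cst x0 x1 c1) (C1_on_cexp x0 x1 (- k)))
  (C1_onM (C1_on_cst x0 x1 c2) (C1_on_cexp x0 x1 k))) => x.
by rewrite /trig; ring.
Qed.

Lemma normc_trig (c1 c2 : R[i]) (r : R) x :
  normc (trig c1 c2 ('i * r%:C) x) <= normc c1 + normc c2.
Proof.
apply: le_trans (ler_normcD _ _) _; rewrite !normc_mul !normc_cexp.
by rewrite /= !(mul0r, mulr0, subrr, subr0, oppr0, expR0) !mulr1.
Qed.

Lemma cexp_i_pi : cexp 'i pi = -1 :> R[i].
Proof.
rewrite /cexp /= !mul0r !mul1r expR0 cospi sinpi !mul1r.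
by apply/eqP; rewrite eq_complex /= !oppr0 !eqxx.
Qed.

Lemma cexp_nat (w : R[i]) k x : cexp (w * k%:R) x = cexp w x ^+ k.
Proof.
elim: k => [|k IH]; first by rewrite mulr0 cexp0l expr0.
by rewrite -addn1 natrD mulrDr cexpD IH mulr1 exprD expr1.
Qed.

Lemma cexp_int_pi (n : int) : cexp ('i * n%:~R) pi = (-1) ^+ `|n|%N :> R[i].
Proof.
case: n => n; first by rewrite cexp_nat cexp_i_pi.
rewrite NegzE mulrNz mulrN abszN /=.
have h : cexp (- ('i * n.+1%:R)) pi * (-1) ^+ n.+1 = 1 :> R[i].
  by rewrite -cexp_i_pi -cexp_nat cexpNK.
have s0 : (-1) ^+ n.+1 != 0 :> R[i] by rewrite signr_eq0.
by apply: (mulIf s0); rewrite h -[RHS]expr2 sqrr_sign.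
Qed.

Variables (c : R) (a A b B lam : R[i]) (n : int) (z : R[i]).
Hypothesis c1 : 1 <= c.
Hypotheses (a_le : normc a <= c) (A_le : normc A <= c)
  (b_le : normc b <= c) (B_le : normc B <= c).
Hypothesis lamE : lam = n%:~R + z.
Hypothesis z_le : normc z <= 1 / 2.
Variable nu : R.
Hypothesis nuE : `|n|%N%:R = nu.
Hypothesis nu4 : 4 <= nu.
Hypothesis nuc : 8 * c ^+ 2 <= nu.

(* phi removes the nonresonant coupling of y1 to y2. What it leaves, - 'i * phi * Q,
   has the mean 'i * kappa, which is the shift of the eigenvalue, and a rest that psi
   removes; chi removes the coupling to y2 that psi brings in, up to O(1 / nu ^+ 2). *)
Let l1 := 2 * lam - 2.
Let l2 := 2 * lam + 2.
Let kappa := a * B / l1 + A * b / l2.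

Let P := trig a A ('i * 2%:C).
Let Q := trig b B ('i * 2%:C).
Let phi := trig (- (a / l1)) (- (A / l2)) ('i * 2%:C).
Let psi := trig (a * b / (4 * l1)) (- (A * B / (4 * l2))) ('i * 4%:C).
Let dP := trig (- ('i * 2%:C) * a) ('i * 2%:C * A) ('i * 2%:C).
Let dphi := trig (- ('i * 2%:C) * - (a / l1)) ('i * 2%:C * - (A / l2)) ('i * 2%:C).
Let dpsi := trig (- ('i * 4%:C) * (a * b / (4 * l1)))
   ('i * 4%:C * - (A * B / (4 * l2))) ('i * 4%:C).
Let chi x := - (2 * lam)^-1 * (P x * psi x).
Let dchi x := - (2 * lam)^-1 * (dP x * psi x + P x * dpsi x).

Lemma normc_int (k : int) : normc (k%:~R : R[i]) = `|k|%N%:R.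
Proof.
by case: k => k; rewrite ?NegzE ?mulrNz ?normc_opp normc_nat.
Qed.

Lemma lam_shift_ge (k : R[i]) : normc k <= 2 -> nu <= normc (2 * lam + k).
Proof.
move=> k2; have -> : 2 * lam + k = 2 * n%:~R - - (2 * z + k) by rewrite lamE; ring.
have := ler_subnormc (2 * n%:~R) (- (2 * z + k)).
have := ler_normcD (2 * z) k.
rewrite normc_opp !normc_mul normc_int normc_nat nuE.
move: k2 z_le nu4; move: (normc k) (normc z) (normc (2 * z + k)) (normc (_ - _)) nu => *; lra.
Qed.

Lemma l1_ge : nu <= normc l1.
Proof. by apply: lam_shift_ge; rewrite normc_opp normc_nat. Qed.
Lemma l2_ge : nu <= normc l2.
Proof. by apply: lam_shift_ge; rewrite normc_nat. Qed.
Lemma l0_ge : nu <= normc (2 * lam).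
Proof. by rewrite -[2 * lam]addr0; apply: lam_shift_ge; rewrite normc_0. Qed.

Lemma nu_gt0 : 0 < nu. Proof. exact: lt_le_trans nu4. Qed.

Lemma l1_neq0 : l1 != 0. Proof. by rewrite -normc_gt0; exact: lt_le_trans nu_gt0 l1_ge. Qed.
Lemma l2_neq0 : l2 != 0. Proof. by rewrite -normc_gt0; exact: lt_le_trans nu_gt0 l2_ge. Qed.
Lemma lam_neq0 : lam != 0.
Proof.
have : 2 * lam != 0 by rewrite -normc_gt0; exact: lt_le_trans nu_gt0 l0_ge.
by apply: contraNneq => ->; rewrite mulr0.
Qed.

Lemma div_le (x l : R[i]) (M : R) : normc x <= M -> nu <= normc l -> normc (x / l) <= M / nu.
Proof.
move=> xM nl; rewrite normc_mul normc_inv.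
have nu0 := nu_gt0.
by rewrite ler_pM ?normc_ge0 ?invr_ge0 ?normc_ge0 // lef_pV2 ?posrE //; exact: lt_le_trans nl.
Qed.

Lemma mul_le (x y : R[i]) (M M' : R) : normc x <= M -> normc y <= M' -> normc (x * y) <= M * M'.
Proof. by move=> ? ?; rewrite normc_mul ler_pM ?normc_ge0. Qed.

Lemma normc_i_mul (r : R) (x : R[i]) : 0 <= r -> normc ('i * r%:C * x) = r * normc x.
Proof.
move=> r0; rewrite !normc_mul normc_real ger0_norm //; congr (_ * _).
by rewrite /= expr0n /= expr1n add0r sqrtr1 mul1r.
Qed.

Lemma P_le x : normc (P x) <= 2 * c.
Proof. by apply: le_trans (normc_trig _ _ _ _) _; have := a_le; have := A_le; lra. Qed.
Lemma Q_le x : normc (Q x) <= 2 * c.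
Proof. by apply: le_trans (normc_trig _ _ _ _) _; have := b_le; have := B_le; lra. Qed.
Lemma dP_le x : normc (dP x) <= 4 * c.
Proof.
apply: le_trans (normc_trig _ _ _ _) _.
by rewrite mulNr normc_opp !normc_i_mul //; have := a_le; have := A_le; lra.
Qed.
Lemma phi_le x : normc (phi x) <= 2 * c / nu.
Proof.
apply: le_trans (normc_trig _ _ _ _) _; rewrite !normc_opp.
by have := div_le a_le l1_ge; have := div_le A_le l2_ge; lra.
Qed.

Lemma div4_le (x y l : R[i]) : normc x <= c -> normc y <= c -> nu <= normc l ->
  normc (x * y / (4 * l)) <= c ^+ 2 / (4 * nu).
Proof.
move=> xc yc nl; have -> : x * y / (4 * l) = x * y / l / 4 by rewrite invfM; ring.
have -> : c ^+ 2 / (4 * nu) = c * c / nu / 4 by rewrite invfM; ring.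
by rewrite [leLHS]normc_mul normc_inv normc_nat ler_wpM2r // div_le // mul_le.
Qed.

Lemma psi_le x : normc (psi x) <= c ^+ 2 / nu.
Proof.
apply: le_trans (normc_trig _ _ _ _) _; rewrite normc_opp.
have := div4_le a_le b_le l1_ge; have := div4_le A_le B_le l2_ge.
have -> : c ^+ 2 / (4 * nu) = c ^+ 2 / nu / 4 by rewrite invfM; ring.
have := nu_gt0 => nu0; have : 0 <= c ^+ 2 / nu by rewrite divr_ge0 ?sqr_ge0 // ltW.
lra.
Qed.

Lemma dpsi_le x : normc (dpsi x) <= 2 * c ^+ 2 / nu.
Proof.
apply: le_trans (normc_trig _ _ _ _) _; rewrite mulNr normc_opp !normc_i_mul // normc_opp.
have := div4_le a_le b_le l1_ge; have := div4_le A_le B_le l2_ge.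
have -> : c ^+ 2 / (4 * nu) = c ^+ 2 / nu / 4 by rewrite invfM; ring.
lra.
Qed.

Lemma kappa_le : normc kappa <= 2 * c ^+ 2 / nu.
Proof.
apply: le_trans (ler_normcD _ _) _.
by have := div_le (mul_le a_le B_le) l1_ge; have := div_le (mul_le A_le b_le) l2_ge; lra.
Qed.

Lemma chi_le x : normc (chi x) <= 2 * c ^+ 3 / nu ^+ 2.
Proof.
rewrite /chi mulNr normc_opp mulrC.
have -> : 2 * c ^+ 3 / nu ^+ 2 = 2 * c * (c ^+ 2 / nu) / nu by rewrite expr2 invfM; ring.
exact: div_le (mul_le (P_le x) (psi_le x)) l0_ge.
Qed.

Lemma dchi_le x : normc (dchi x) <= 8 * c ^+ 3 / nu ^+ 2.
Proof.
rewrite /dchi mulNr normc_opp mulrC.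
have -> : 8 * c ^+ 3 / nu ^+ 2 = (4 * c * (c ^+ 2 / nu) + 2 * c * (2 * c ^+ 2 / nu)) / nu.
  by rewrite expr2 invfM; ring.
apply: div_le l0_ge; apply: le_trans (ler_normcD _ _) _.
by apply: lerD; apply: mul_le; [exact: dP_le|exact: psi_le|exact: P_le|exact: dpsi_le].
Qed.

Lemma dphiE x : dphi x = - (2 * 'i * lam * phi x) - 'i * P x.
Proof.
have h1 := l1_neq0; have h2 := l2_neq0; rewrite /dphi /phi /P /trig.
have two : 2%:C = 2 :> R[i] by rewrite rmorph_nat.
rewrite two; move: (cexp _ x) (cexp _ x) => v u.
have aE : a = a / l1 * (2 * lam - 2) by rewrite divfK.
have AE : A = A / l2 * (2 * lam + 2) by rewrite divfK.
have -> : a * u + A * v = a / l1 * (2 * lam - 2) * u + A / l2 * (2 * lam + 2) * v.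
  by rewrite -aE -AE.
by move: (a / l1) (A / l2) => X Y; ring.
Qed.

Lemma mul_ii : 'i * 'i = -1 :> R[i]. Proof. by rewrite -expr2 sqr_i. Qed.

(** The terms of frequency 0 of the product make up [- kappa], those of frequency
    4 and -4 the derivative of [psi]. *)
Lemma phiQ x : phi x * Q x = - kappa - 'i * dpsi x.
Proof.
rewrite /phi /Q /dpsi /kappa /trig.
have four : 4%:C = 4 :> R[i] by rewrite rmorph_nat.
have e4 : 'i * 4%:C = 'i * 2%:C + 'i * 2%:C :> R[i].
  by rewrite -mulrDr -rmorphD /=; congr (_ * _%:C); lra.
have -> : cexp (- ('i * 4%:C)) x = cexp (- ('i * 2%:C)) x * cexp (- ('i * 2%:C)) x.
  by rewrite e4 opprD cexpD.
have -> : cexp ('i * 4%:C) x = cexp ('i * 2%:C) x * cexp ('i * 2%:C) x.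
  by rewrite e4 cexpD.
have := cexpNK ('i * 2%:C) x.
move: (cexp (- ('i * 2%:C)) x) (cexp ('i * 2%:C) x) => u v uv.
rewrite four.
have h1 := l1_neq0; have h2 := l2_neq0.
transitivity (- (a * b / l1) * (u * u) - A * B / l2 * (v * v)
   - (a * B / l1 + A * b / l2) * (u * v)); first by field; apply/andP.
rewrite uv mulr1.
transitivity ('i * 'i * (a * b / l1 * (u * u) + A * B / l2 * (v * v))
   - (a * B / l1 + A * b / l2)); first by rewrite mul_ii; ring.
by field; apply/andP.
Qed.

Variables (y1 y2 : R -> R[i]) (U : R).
Let d1 x := - 'i * lam * y1 x + 'i * P x * y2 x.
Let d2 x := 'i * lam * y2 x - 'i * Q x * y1 x.
Hypothesis y1_C1 : C1_on 0 pi y1 d1.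
Hypothesis y2_C1 : C1_on 0 pi y2 d2.
Hypothesis y1_pi : y1 pi = (-1) ^+ `|n|%N * y1 0.
Hypothesis y2_pi : y2 pi = (-1) ^+ `|n|%N * y2 0.
Hypothesis y1_le : forall x, x \in `[0, pi] -> normc (y1 x) <= U.
Hypothesis y2_le : forall x, x \in `[0, pi] -> normc (y2 x) <= U.

Let mu := kappa - lam.
Let W x := y1 x + (phi x * y2 x + (psi x * y1 x + chi x * y2 x)).
Let corr x := phi x * y2 x + psi x * y1 x + chi x * y2 x.
Let rem x := - 'i * kappa * corr x + dchi x * y2 x - 'i * chi x * Q x * y1 x.

Lemma chiE x : 2 * lam * chi x = - (P x * psi x).
Proof. by rewrite /chi; have := lam_neq0 => h; field. Qed.

(** In the new unknown [W] the equation is scalar up to [rem], which is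
    [O(1 / nu ^+ 2)]. *)
Lemma W_derivative : C1_on 0 pi W (fun x => 'i * mu * W x + rem x).
Proof.
have phiC : C1_on 0 pi phi dphi by exact: C1_on_trig.
have psiC : C1_on 0 pi psi dpsi by exact: C1_on_trig.
have PC : C1_on 0 pi P dP by exact: C1_on_trig.
have chiC : C1_on 0 pi chi dchi.
  apply: C1_on_eq (C1_onM (C1_on_cst 0 pi (- (2 * lam)^-1)) (C1_onM PC psiC)) => x.
  by rewrite mul0r add0r.
apply: C1_on_eq (C1_onD y1_C1 (C1_onD (C1_onM phiC y2_C1)
  (C1_onD (C1_onM psiC y1_C1) (C1_onM chiC y2_C1)))) => x.
rewrite /d1 /d2 /W /rem /corr /mu dphiE.
have hphi := phiQ x; have hchi := chiE x.
transitivity ('i * (kappa - lam) * (y1 x + (phi x * y2 x + (psi x * y1 x + chi x * y2 x))) +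
  (- 'i * kappa * (phi x * y2 x + psi x * y1 x + chi x * y2 x) + dchi x * y2 x -
   'i * chi x * Q x * y1 x)
  - 'i * y1 x * (phi x * Q x + kappa + 'i * dpsi x) + ('i * 'i + 1) * dpsi x * y1 x
  + 'i * y2 x * (2 * lam * chi x + P x * psi x)); first by ring.
by rewrite hphi hchi mul_ii; ring.
Qed.

Let V x := cexp (- ('i * mu)) x * W x.

Lemma V_derivative : C1_on 0 pi V (fun x => cexp (- ('i * mu)) x * rem x).
Proof.
apply: C1_on_eq (C1_onM (C1_on_cexp 0 pi (- ('i * mu))) W_derivative) => x; ring.
Qed.

Local Notation K2 := (corr_const c).
Local Notation K1 := (rem_const c).

Lemma normc_i (x : R[i]) : normc ('i * x) = normc x.
Proof. by have := @normc_i_mul 1 x ler01; rewrite mulr1 mul1r. Qed.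

Lemma pi_itv : (0 : R) \in `[0, pi] /\ (pi : R) \in `[0, pi].
Proof. by rewrite !in_itv /= !lexx pi_ge0. Qed.

Lemma U_ge0 : 0 <= U.
Proof. by apply: le_trans (normc_ge0 _) (y1_le pi_itv.1). Qed.

Lemma c_ge0 : 0 <= c. Proof. exact: le_trans ler01 c1. Qed.

Lemma corr_le x : x \in `[0, pi] -> normc (corr x) <= K2 / nu * U.
Proof.
move=> xI; have U0 := U_ge0; have nu0 := nu_gt0; have c0 := c_ge0.
apply: (@le_trans _ _ (2 * c / nu * U + c ^+ 2 / nu * U + 2 * c ^+ 3 / nu ^+ 2 * U)).
  apply: le_trans (ler_normcD _ _) _; apply: lerD; last exact: mul_le (chi_le x) (y2_le xI).
  apply: le_trans (ler_normcD _ _) _.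
  by apply: lerD; [exact: mul_le (phi_le x) (y2_le xI)|exact: mul_le (psi_le x) (y1_le xI)].
have -> : K2 / nu * U = 2 * c / nu * U + c ^+ 2 / nu * U + 2 * c ^+ 3 / nu * U.
  by rewrite /corr_const; ring.
rewrite lerD2l; apply: ler_wpM2r => //.
apply: ler_wpM2l; first by rewrite mulr_ge0 // exprn_ge0.
rewrite lef_pV2 ?posrE ?exprn_gt0 // expr2 ler_peMl ?(ltW nu0) //.
by apply: le_trans nu4; rewrite ler1n.
Qed.

Lemma rem_le x : x \in `[0, pi] -> normc (rem x) <= K1 / nu ^+ 2 * U.
Proof.
move=> xI; have U0 := U_ge0; have nu0 := nu_gt0; have c0 := c_ge0.
have -> : K1 / nu ^+ 2 * U = 2 * c ^+ 2 / nu * (K2 / nu * U) +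
    8 * c ^+ 3 / nu ^+ 2 * U + 2 * c ^+ 3 / nu ^+ 2 * (2 * c) * U.
  by rewrite /rem_const; field; rewrite gt_eqF.
apply: le_trans (ler_normcB _ _) _; apply: lerD; last first.
  have -> : 'i * chi x * Q x * y1 x = 'i * (chi x * Q x * y1 x) by ring.
  rewrite normc_i; apply: mul_le (y1_le xI).
  exact: mul_le (chi_le x) (Q_le x).
apply: le_trans (ler_normcD _ _) _; apply: lerD; last exact: mul_le (dchi_le x) (y2_le xI).
rewrite mulNr mulNr normc_opp -mulrA normc_i.
exact: mul_le kappa_le (corr_le xI).
Qed.

(* The exponentials below have a growth rate of at most 1 on [0, pi], and pi <= 4. *)
Local Notation E4 := (expR 4 : R).

Lemma kappa_half : normc kappa <= 1 / 2.
Proof.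
apply: le_trans kappa_le _; rewrite ler_pdivrMr ?nu_gt0 //.
have := nuc; have := nu_gt0; lra.
Qed.

Lemma zk_le : normc (z - kappa) <= 1.
Proof.
by apply: le_trans (ler_normcB _ _) _; have := z_le; have := kappa_half; lra.
Qed.

Lemma cexp_mu_le (w : R[i]) x : `|Re w| <= 1 -> x \in `[0, pi] -> normc (cexp w x) <= E4.
Proof.
move=> w1; rewrite normc_cexp ler_expR in_itv /= => /andP[x0 xpi].
have pi4 := @pi_le4 R; apply: le_trans (ler_norm _) _.
rewrite normrM (ger0_norm x0) -[4]mul1r ler_pM //; lra.
Qed.

Lemma Re_imu : `|Re ('i * mu)| <= 1.
Proof.
have -> : 'i * mu = - ('i * (z - kappa)) - 'i * n%:~R by rewrite /mu lamE; ring.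
rewrite ReB (_ : Re ('i * n%:~R) = 0) ?subr0; last first.
  rewrite -[n%:~R](@rmorph_int _ _ (real_complex R)) /= ?mul0r.
  by rewrite mul1r subr0.
by apply: le_trans (normc_ge_absRe _) _; rewrite normc_opp normc_i zk_le.
Qed.

Variable k0 : R.
Hypothesis k0_gt0 : 0 < k0.
Hypothesis k0_lower :
  forall w : R[i], normc w <= 3 / 4 -> k0 * normc w <= normc (cexp ('i * w) pi - 1).

Local Notation K := (component_const c k0).

(** From 0 to [pi], [W] is multiplied by the same sign as [y1], while the equation
    makes it a multiple of [e ^ (i mu x)] up to [O(U / nu ^+ 2)]. Comparing the two at [pi]
    bounds [e ^ (i (z - kappa) pi) - 1] unless [W 0] is small, and in that case
    all of [y1] is small. *)
Lemma component_estimate : exists2 w0 : R, 0 <= w0 &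
  normc (z - kappa) * w0 <= K * U / nu ^+ 2 /\
  forall x, x \in `[0, pi] -> normc (y1 x) <= K * (w0 + U / nu).
Proof.
have U0 := U_ge0; have nu0 := nu_gt0; have c0 := c_ge0.
have E0 : 0 < E4 by exact: expR_gt0.
have K20 : 0 <= K2 by rewrite /corr_const !addr_ge0 ?mulr_ge0 ?exprn_ge0.
have K10 : 0 <= K1 by rewrite /rem_const !addr_ge0 ?mulr_ge0 ?exprn_ge0.
have [I0 Ipi] := pi_itv.
pose M := E4 * (K1 / nu ^+ 2 * U).
have M0 : 0 <= M by rewrite !mulr_ge0 ?invr_ge0 ?exprn_ge0 // ltW.
have Re_neg : `|Re (- ('i * mu))| <= 1.
  by rewrite -[- _]add0r ReB /= sub0r normrN; exact: Re_imu.
have V_le x : x \in `[0, pi] -> normc (V x - V 0) <= 8 * M.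
  move=> xI; have := @mean_value_ineq _ _ _ _ _ M V_derivative _ x xI.
  have h : forall t, t \in `]0, pi[ -> normc (cexp (- ('i * mu)) t * rem t) <= M.
    move=> t tI; have tI' : t \in `[0, pi] by exact: subset_itv_oo_cc.
    by apply: mul_le; [exact: cexp_mu_le|exact: rem_le].
  move=> /(_ h) /le_trans; apply; rewrite subr0.
  move: xI; rewrite in_itv /= => /andP[x0 xpi]; have := @pi_le4 R => pi4.
  have -> : 8 * M = 2 * M * 4 by ring.
  by apply: ler_wpM2l; [rewrite mulr_ge0 | exact: le_trans pi4].
have V0E : V 0 = W 0 by rewrite /V cexp0r mul1r.
have W_pi : W pi = (-1) ^+ `|n|%N * W 0.
  have per c' c'' (k : nat) : trig c' c'' ('i * (2 * k)%:R%:C) pi = trig c' c'' ('i * (2 * k)%:R%:C) 0.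
    have e : cexp ('i * (2 * k)%:R%:C) pi = 1 :> R[i].
      by rewrite rmorph_nat cexp_nat cexp_i_pi exprM sqrrN !expr1n.
    have e' : cexp (- ('i * (2 * k)%:R%:C)) pi = 1 :> R[i].
      by have := cexpNK ('i * (2 * k)%:R%:C) (pi : R); rewrite e mulr1.
    by rewrite /trig e e' !cexp0r.
  have P_pi : P pi = P 0 by exact: (per _ _ 1%N).
  have phi_pi : phi pi = phi 0 by exact: (per _ _ 1%N).
  have psi_pi : psi pi = psi 0 by exact: (per _ _ 2%N).
  have chi_pi : chi pi = chi 0 by rewrite /chi P_pi psi_pi.
  by rewrite /W phi_pi psi_pi chi_pi y1_pi y2_pi; ring.
have V_pi : V pi = cexp ('i * (z - kappa)) pi * W 0.
  rewrite /V W_pi mulrA; congr (_ * _).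
  have -> : - ('i * mu) = 'i * (z - kappa) + 'i * n%:~R by rewrite /mu lamE; ring.
  by rewrite cexpD cexp_int_pi -mulrA -expr2 sqrr_sign mulr1.
exists (normc (W 0)); first exact: normc_ge0.
split.
  have : k0 * normc (z - kappa) * normc (W 0) <= 8 * M.
    apply: le_trans (V_le _ Ipi); rewrite V_pi V0E.
    have -> : cexp ('i * (z - kappa)) pi * W 0 - W 0 =
      (cexp ('i * (z - kappa)) pi - 1) * W 0 by ring.
    rewrite [leRHS]normc_mul ler_wpM2r ?normc_ge0 // k0_lower //.
    apply: le_trans (ler_normcB _ _) _; have := z_le => z2.
    suff : normc kappa <= 1 / 4 by lra.
    apply: le_trans kappa_le _; rewrite ler_pdivrMr //; have := nuc; lra.
  have -> : k0 * normc (z - kappa) * normc (W 0) = normc (z - kappa) * normc (W 0) * k0 by ring.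
  rewrite -ler_pdivlMr // => /le_trans; apply.
  have -> : 8 * M / k0 = 8 * E4 * K1 / k0 * U / nu ^+ 2 by rewrite /M; ring.
  apply: ler_wpM2r; first by rewrite invr_ge0 exprn_ge0 // ltW.
  apply: ler_wpM2r => //; rewrite /component_const lerDr addr_ge0 //.
  by rewrite mulr_ge0 ?(ltW E0) // addr_ge0 // mulr_ge0 // mulr_ge0 // ltW.
move=> x xI.
have -> : y1 x = cexp ('i * mu) x * V x - corr x.
  rewrite /V mulrA -{1}['i * mu]opprK cexpNK mul1r /W /corr; ring.
apply: le_trans (ler_normcB _ _) _.
have h1 : normc (cexp ('i * mu) x * V x) <= E4 * (normc (W 0) + 8 * M).
  apply: mul_le; first by apply: cexp_mu_le => //; exact: Re_imu.
  have -> : V x = W 0 + (V x - V 0) by rewrite V0E addrC subrK.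
  by apply: le_trans (ler_normcD _ _) _; rewrite lerD2l V_le.
apply: le_trans (lerD h1 (corr_le xI)) _.
have M_le : M <= E4 * K1 * (U / nu).
  have -> : E4 * K1 * (U / nu) = E4 * (K1 / nu * U) by ring.
  apply: ler_wpM2l; first exact: ltW.
  apply: ler_wpM2r => //; apply: ler_wpM2l => //.
  rewrite lef_pV2 ?posrE ?exprn_gt0 // expr2 ler_peMl ?(ltW nu0) //.
  by apply: le_trans nu4; rewrite ler1n.
have w0 := normc_ge0 (W 0); have Un : 0 <= U / nu by rewrite divr_ge0 // ltW.
have K3 : 0 <= 8 * E4 * K1 / k0 by rewrite divr_ge0 ?mulr_ge0 // ltW.
have E1 : 0 <= 8 * E4 * K1 by rewrite !mulr_ge0 // ltW.
apply: (@le_trans _ _ (E4 * (normc (W 0) + 8 * (E4 * K1 * (U / nu))) + K2 * (U / nu))).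
  apply: lerD; last by rewrite mulrAC mulrA.
  by rewrite ler_pM2l // lerD2l ler_pM2l.
rewrite /component_const; move: (normc (W 0)) (U / nu) w0 Un => w u w0 u0.
have p1 : 0 <= E4 * (8 * E4 * K1) * w by rewrite mulr_ge0 // mulr_ge0 // ltW.
have p2 : 0 <= K2 * w by rewrite mulr_ge0.
have p3 : 0 <= 8 * E4 * K1 / k0 * (w + u) by rewrite mulr_ge0 // addr_ge0.
have p4 : 0 <= E4 * u by rewrite mulr_ge0 // ltW.
rewrite -subr_ge0.
have -> : (E4 * (1 + 8 * E4 * K1) + K2 + 8 * E4 * K1 / k0) * (w + u) -
    (E4 * (w + 8 * (E4 * K1 * u)) + K2 * u) =
  E4 * (8 * E4 * K1) * w + K2 * w + 8 * E4 * K1 / k0 * (w + u) + E4 * u by ring.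
by rewrite !addr_ge0.
Qed.

End NormalForm.

(** * Location of the eigenvalues *)
Section Eigenfunctions.
Variable R : realType.
Local Open Scope classical_set_scope.
Local Open Scope ring_scope.
Local Open Scope complex_scope.
Local Notation Re := (@complex.Re R).
Local Notation Im := (@complex.Im R).

(** Take the last function of the chain that does not vanish. *)
Lemma root_function_eigenfunction (P Q : R -> R[i]) n lam y : root_function P Q n lam y ->
  (exists2 x, x \in `[0, pi] & y x <> (0, 0)) ->
  exists y' w, [/\ dirac_shift P Q n lam y' w,
    forall x, x \in `[0, pi] -> w x = (0, 0) &
    exists2 x, x \in `[0, pi] & y' x <> (0, 0)].
Proof.
case=> k; elim: k y => [|k IH] y /=; first by move=> y0 [x /y0].
move=> [w [yw kw]] y_neq0.
have [[x xI wx]|w0] := pselect (exists2 x, x \in `[0, pi] & w x <> (0, 0)).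
  by apply: (IH w) => //; exists x.
exists y, w; split=> // x xI; apply: contrapT => wx; apply: w0; exists x => //.
Qed.

(** Were the first basis function to vanish, the zero function would have several
    coordinate vectors. *)
Lemma multiplicity_eigenfunction (P Q : R -> R[i]) n lam k :
  algebraic_multiplicity P Q n lam k.+1 ->
  exists y w, [/\ dirac_shift P Q n lam y w,
    forall x, x \in `[0, pi] -> w x = (0, 0) &
    exists2 x, x \in `[0, pi] & y x <> (0, 0)].
Proof.
move=> [e [e_root e_basis]].
apply: (root_function_eigenfunction (e_root ord0)).
apply: contrapT => e0.
have {}e0 x : x \in `[0, pi] -> e ord0 x = (0, 0).
  by move=> xI; apply: contrapT => ex; apply: e0; exists x.
have zero_root : root_function P Q n lam (fun=> (0, 0)) by exists 0%N.
have [c [_ c_uniq]] := e_basis _ zero_root.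
have h0 : c = [ffun=> 0].
  apply: c_uniq => x _; split; rewrite /= big1 // => i _; by rewrite ffunE mul0r.
have : c = [ffun i => if i == ord0 then 1 else 0].
  apply: c_uniq => x xI; split; rewrite /= big1 // => i _; rewrite ffunE; case: eqP => [->|_];
    rewrite ?e0 ?mulr0 ?mul0r //.
rewrite h0 => /ffunP /(_ ord0); rewrite !ffunE eqxx => /esym/eqP.
by rewrite oner_eq0.
Qed.

Lemma potentialE (a A : R[i]) x : potential a A x = trig a A ('i * 2%:C) x.
Proof.
rewrite /potential /trig /expi /cexp /= !(mul0r, mulr0, mul1r, subr0, subrr, addr0, add0r, oppr0, expR0).
by rewrite mulNr.
Qed.

Lemma normc_lipschitz (w z : R[i]) : `|normc w - normc z| <= normc (w - z).
Proof.
rewrite ler_norml ler_subnormc andbT lerNl opprB.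
by rewrite -(normc_opp (w - z)) opprB ler_subnormc.
Qed.

Lemma dirac_C1 (P Q : R -> R[i]) n lam y w : dirac_shift P Q n lam y w ->
  (forall x, x \in `[0, pi] -> w x = (0, 0)) ->
  C1_on 0 pi (fun x => (y x).1) (fun x => - 'i * lam * (y x).1 + 'i * P x * (y x).2) /\
  C1_on 0 pi (fun x => (y x).2) (fun x => 'i * lam * (y x).2 - 'i * Q x * (y x).1).
Proof.
move=> [c1 c2 _ _ eqs] w0; have i2 : 'i * 'i = -1 :> R[i] by rewrite -expr2 sqr_i.
have k1 := continuous_on_CP c1; have k2 := continuous_on_CP c2.
split; (split; first by [exact: k1|exact: k2]).
  move=> x xI; have [d1 [d2 [D1 _ E _]]] := eqs x xI.
  rewrite w0 /= in E; last exact: subset_itv_oo_cc.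
  suff <- : d1 = - 'i * lam * (y x).1 + 'i * P x * (y x).2 by [].
  have -> : d1 = - 'i * ('i * d1 + P x * (y x).2 - lam * (y x).1)
    + ('i * 'i + 1) * d1 + ('i * P x * (y x).2 - 'i * lam * (y x).1) by ring.
  rewrite E i2; ring.
move=> x xI; have [d1 [d2 [_ D2 _ E]]] := eqs x xI.
rewrite w0 /= in E; last exact: subset_itv_oo_cc.
suff <- : d2 = 'i * lam * (y x).2 - 'i * Q x * (y x).1 by [].
have -> : d2 = 'i * (- 'i * d2 + Q x * (y x).1 - lam * (y x).2)
  + ('i * 'i + 1) * d2 + ('i * lam * (y x).2 - 'i * Q x * (y x).1) by ring.
rewrite E i2; ring.
Qed.

(** The second component solves the same system after [lam], [n], the potentials
    and hence [z] and [kappa] change sign, so [component_estimate] applies to both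
    components. They cannot both be small at 0, because the maximum of
    [|y1| + |y2|] is attained. *)
Lemma resonant_eigenvalue (c : R) : 1 <= c -> exists K : R, exists2 M : R, 0 < M &
  forall (a A b B : R[i]) (n : int) (lam : R[i]) (y w : R -> R[i] * R[i]),
    normc a <= c -> normc A <= c -> normc b <= c -> normc B <= c ->
    M <= `|n|%N%:R -> normc (lam - n%:~R) <= 1 / 2 ->
    dirac_shift (potential a A) (potential b B) n lam y w ->
    (forall x, x \in `[0, pi] -> w x = (0, 0)) ->
    (exists2 x, x \in `[0, pi] & y x <> (0, 0)) ->
    normc (lam - n%:~R - (a * B + A * b) / (2 * n%:~R)) <= K / `|n|%N%:R ^+ 2.
Proof.
move=> c1; have c0 : 0 <= c by lra.
have [k0 k0_gt0 k0_low] := cexp_pi_sub1_lower R.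
set K0 := component_const c k0; have K01 : 1 <= K0 by exact: component_const_ge1.
have c2 : 0 <= c ^+ 2 by exact: sqr_ge0.
(* The last summand of the threshold lets the terms U / nu of both component
   estimates be absorbed into U. *)
exists (4 * K0 ^+ 2 + 3 * c ^+ 2), (4 + 8 * c ^+ 2 + 4 * K0); first lra.
move=> a A b B n lam y w a_le A_le b_le B_le.
set nu : R := `|n|%N%:R => nu_M z_le yw w0 [x0 x0I y0].
have nuE : `|n|%N%:R = nu by [].
have nu4 : 4 <= nu by lra.
have nuc : 8 * c ^+ 2 <= nu by lra.
have nu_K : 4 * K0 <= nu by lra.
have nu0 : 0 < nu by lra.
have [y1C y2C] := dirac_C1 yw w0.
have [cy1 cy2 y1pi y2pi _] := yw.
pose Y x := normc (y x).1 + normc (y x).2.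
have cY : {within `[0, pi], continuous Y}.
  have n1 : {within `[0, pi], continuous (fun x => normc (y x).1)}.
    exact: (within_continuous_lip normc_lipschitz cy1).
  have n2 : {within `[0, pi], continuous (fun x => normc (y x).2)}.
    exact: (within_continuous_lip normc_lipschitz cy2).
  by move=> x; apply: cvgD; [exact: n1|exact: n2].
have [xm xmI Y_max] := EVT_max (pi_ge0 R) cY.
set U := Y xm in Y_max.
have y1_le x : x \in `[0, pi] -> normc (y x).1 <= U.
  by move=> /Y_max; apply: le_trans; rewrite lerDl normc_ge0.
have y2_le x : x \in `[0, pi] -> normc (y x).2 <= U.
  by move=> /Y_max; apply: le_trans; rewrite lerDr normc_ge0.
have U_gt0 : 0 < U.
  apply: lt_le_trans (Y_max _ x0I); rewrite lt_neqAle addr_ge0 ?normc_ge0 // andbT eq_sym.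
  rewrite paddr_eq0 ?normc_ge0 // !normc_eq0; apply: contra_notN y0.
  by case: (y x0) => u v /= /andP[/eqP -> /eqP ->].
pose z := lam - n%:~R.
pose kappa := a * B / (2 * lam - 2) + A * b / (2 * lam + 2).
have lamE : lam = n%:~R + z by rewrite addrC subrK.
have y1C' : C1_on 0 pi (fun x => (y x).1) (fun x => - 'i * lam * (y x).1
    + 'i * trig a A ('i * 2%:C) x * (y x).2).
  by apply: C1_on_eq y1C => x; rewrite potentialE.
have y2C' : C1_on 0 pi (fun x => (y x).2) (fun x => 'i * lam * (y x).2
    - 'i * trig b B ('i * 2%:C) x * (y x).1).
  by apply: C1_on_eq y2C => x; rewrite potentialE.
have [w1 w1_ge0 [zk1 est1]] := component_estimate c1 a_le A_le b_le B_le lamE z_le nuE nu4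
  nuc y1C' y2C' y1pi y2pi y1_le y2_le k0_gt0 k0_low.
have [w2 w2_ge0 [zk2 est2]] : exists2 w2 : R, 0 <= w2 & normc (z - kappa) * w2 <= K0 * U / nu ^+ 2 /\
  forall x, x \in `[0, pi] -> normc (y x).2 <= K0 * (w2 + U / nu).
  have lamE' : - lam = (- n)%:~R + - z by rewrite lamE rmorphN opprD.
  have nuE' : `|- n|%N%:R = nu by rewrite abszN.
  have y2C'' : C1_on 0 pi (fun x => (y x).2) (fun x => - 'i * - lam * (y x).2
      + 'i * trig (- b) (- B) ('i * 2%:C) x * (y x).1).
    by apply: C1_on_eq y2C' => x; rewrite /trig; ring.
  have y1C'' : C1_on 0 pi (fun x => (y x).1) (fun x => 'i * - lam * (y x).1
      - 'i * trig (- a) (- A) ('i * 2%:C) x * (y x).2).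
    by apply: C1_on_eq y1C' => x; rewrite /trig; ring.
  have := @component_estimate R c (- b) (- B) (- a) (- A) (- lam) (- n) (- z) c1.
  rewrite !normc_opp => /(_ b_le B_le a_le A_le lamE' z_le nu nuE' nu4 nuc _ _ U y2C'' y1C'').
  rewrite abszN => /(_ y2pi y1pi y2_le y1_le k0 k0_gt0 k0_low) [w2 w2_ge0 [h1 h2]].
  exists w2 => //; split=> //; move: h1.
  suff -> : normc (- z - (- b * - A / (2 * - lam - 2) + - B * - a / (2 * - lam + 2))) = normc (z - kappa) by [].
  rewrite -normc_opp; congr normc; rewrite /kappa !mulrNN.
  have -> : 2 * - lam - 2 = - (2 * lam + 2) by ring.
  have -> : 2 * - lam + 2 = - (2 * lam - 2) by ring.
  by rewrite !invrN; ring.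
have U_le : U <= 2 * K0 * (w1 + w2).
  have h : U <= K0 * (w1 + U / nu) + K0 * (w2 + U / nu) by apply: lerD; [exact: est1|exact: est2].
  have : 4 * (K0 * (U / nu)) <= U.
    have -> : 4 * (K0 * (U / nu)) = 4 * K0 * U / nu by ring.
    by rewrite ler_pdivrMr // mulrC ler_pM2l.
  lra.
have zk : normc (z - kappa) <= 4 * K0 ^+ 2 / nu ^+ 2.
  rewrite -(ler_pM2r U_gt0).
  apply: (@le_trans _ _ (2 * K0 * (normc (z - kappa) * w1 + normc (z - kappa) * w2))).
    apply: (@le_trans _ _ (normc (z - kappa) * (2 * K0 * (w1 + w2)))).
      by rewrite ler_wpM2l ?normc_ge0.
    by rewrite le_eqVlt; apply/orP; left; apply/eqP; ring.
  apply: (@le_trans _ _ (2 * K0 * (K0 * U / nu ^+ 2 + K0 * U / nu ^+ 2))).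
    by rewrite ler_wpM2l ?mulr_ge0 ?lerD //; lra.
  by rewrite le_eqVlt; apply/orP; left; apply/eqP; ring.
rewrite -/z.
have -> : z - (a * B + A * b) / (2 * n%:~R) = (z - kappa) +
  (a * B * ((2 * lam - 2)^-1 - (2 * n%:~R)^-1) + A * b * ((2 * lam + 2)^-1 - (2 * n%:~R)^-1)).
  rewrite /kappa; ring.
have dif (k : R[i]) : normc k <= 2 -> normc ((2 * lam + k)^-1 - (2 * n%:~R)^-1) <= 3 / 2 / nu ^+ 2.
  move=> k2; have L := lam_shift_ge lamE z_le nuE nu4 k2.
  have L0 : 2 * lam + k != 0 by rewrite -normc_gt0; exact: lt_le_trans L.
  have nn : normc (n%:~R : R[i]) = nu by rewrite normc_int.
  have n0 : n%:~R != 0 :> R[i] by rewrite -normc_gt0 nn.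
  have -> : (2 * lam + k)^-1 - (2 * n%:~R)^-1 =
      - (2 * z + k) / 2 / ((2 * lam + k) * n%:~R).
    have -> : 2 * z + k = (2 * lam + k) - 2 * n%:~R by rewrite lamE; ring.
    by field; apply/andP.
  have h1 : normc (2 * z + k) <= 3.
    apply: le_trans (ler_normcD _ _) _; rewrite normc_mul normc_nat.
    move: z_le k2; rewrite -/z; move: (normc z) (normc k) => *; lra.
  rewrite mulNr mulNr normc_opp [leLHS]normc_mul normc_inv [normc (_ * n%:~R)]normc_mul nn.
  rewrite [normc (_ / 2)]normc_mul normc_inv normc_nat.
  have h2 : normc (2 * z + k) / 2 <= 3 / 2 by rewrite ler_pM2r ?invr_gt0.
  have h3 : (normc (2 * lam + k) * nu)^-1 <= (nu ^+ 2)^-1.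
    rewrite lef_pV2 ?posrE ?exprn_gt0 ?mulr_gt0 //; last exact: lt_le_trans L.
    by rewrite expr2 ler_pM2r.
  apply: ler_pM => //; first by rewrite divr_ge0 ?normc_ge0.
  by rewrite invr_ge0 mulr_ge0 ?normc_ge0 // ltW.
apply: le_trans (ler_normcD _ _) _; rewrite [leRHS]mulrDl; apply: lerD => //.
apply: le_trans (ler_normcD _ _) _.
have -> : 3 * c ^+ 2 / nu ^+ 2 = c * c * (3 / 2 / nu ^+ 2) + c * c * (3 / 2 / nu ^+ 2) by field; rewrite gt_eqF.
by apply: lerD; apply: mul_le (mul_le _ _) (dif _ _); rewrite ?normc_opp ?normc_nat.
Qed.

End Eigenfunctions.

(** * The asymptotic formulas *)
Section Assembly.
Variable R : realType.
Implicit Types (a A b B z : R[i]) (sg : int).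

Lemma fourier_coef_supp a A k : k != 2 -> k != -2 -> fourier_coef a A k = 0.
Proof. by rewrite /fourier_coef => /negbTE -> /negbTE ->. Qed.

Lemma prod_natr_fact m : \prod_(i < m) (i.+1%:R : R[i]) = (m`!)%:R.
Proof.
elim: m => [|m IH]; first by rewrite big_ord0.
by rewrite big_ord_recr /= IH factS mulnC natrM.
Qed.

Lemma sigma_plus0_fourier a A b B sg m : sg = 1 \/ sg = -1 ->
  let p := fourier_coef a A in let q := fourier_coef b B in
  sigma_plus p q 0 (sg * (2 * m + 1)%N%:Z) 0 =
  p (2 * sg) ^+ m * q (2 * sg) ^+ m.+1 / (4 ^+ (2 * m) * (m`!%:R) ^+ 2).
Proof.
move=> sg1 p q.
have oN : odd (2 * m + 1) by lia.
rewrite (sigma_plus0E p q sg1 oN); congr (_ / _).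
  rewrite big_ltn; last by lia.
  rewrite big_nat_pairs.
  rewrite (eq_bigr (fun=> p (2 * sg) * q (2 * sg))); last first.
    by move=> i _; rewrite /up_weight ifT ?ifF //; lia.
  by rewrite prodr_const card_ord exprMn exprS /up_weight /=; ring.
rewrite big_nat_pairs.
rewrite (eq_bigr (fun i : 'I_m => 4 ^+ 2 * ((m - i)%N%:R * i.+1%:R))); last first.
  move=> i _; have im := ltn_ord i.
  rewrite !(@site_den_gap R sg m sg1) //; [|lia|lia].
  rewrite mulr0 !addr0 gap_odd gap_even !natrM /=.
  transitivity (sg%:~R * sg%:~R * (4 ^+ 2 * ((m - i)%N%:R * i.+1%:R)) : R[i]); first by ring.
  by rewrite (sign_sqr R sg1) mul1r.
have -> : \prod_(i < m) (4 ^+ 2 * ((m - i)%N%:R * i.+1%:R)) =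
    4 ^+ (2 * m) * ((\prod_(i < m) (m - i)%N%:R) * \prod_(i < m) i.+1%:R) :> R[i].
  rewrite big_split /= prodr_const card_ord -exprM; congr (_ * _).
  by rewrite big_split.
congr (_ * _).
rewrite prod_natr_fact expr2; congr (_ * _).
rewrite -prod_natr_fact (reindex_inj rev_ord_inj) /=; apply: eq_bigr => i _.
by congr (_%:R); have := ltn_ord i; lia.
Qed.

Definition coef_bound a A b B : R := 1 + normc a + normc A + normc b + normc B.

Lemma coef_boundP a A b B (c := coef_bound a A b B) :
  [/\ 1 <= c, normc a <= c, normc A <= c, normc b <= c & normc B <= c].
Proof.
rewrite /c /coef_bound.
have := normc_ge0 a; have := normc_ge0 A; have := normc_ge0 b; have := normc_ge0 B.
by move: (normc a) (normc A) (normc b) (normc B) => *; split; lra.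
Qed.

Lemma fourier_coef_le a A (c : R) k : 0 <= c -> normc a <= c -> normc A <= c ->
  normc (fourier_coef a A k) <= c.
Proof.
by rewrite /fourier_coef; case: ifP => // _; case: ifP => // _; rewrite normc_0.
Qed.

Lemma eventually_le_nat (x : R) : exists M : nat, forall m, (M <= m)%N -> x <= m%:R.
Proof.
exists (Num.truncn x).+1 => m Mm; apply/ltW/(lt_le_trans (truncnS_gt _)).
by rewrite ler_nat.
Qed.

Lemma sum_le_each M1 M2 M3 M4 m : (M1 + M2 + M3 + M4 + 4 <= m)%N ->
  [/\ (M1 <= m)%N, (M2 <= m)%N, (M3 <= m)%N, (M4 <= m)%N & (4 <= m)%N].
Proof. by move=> ?; split; lia. Qed.

Lemma total_defect_le m (w W c : R) : (4 <= m)%N -> 0 <= W -> w <= W / m%:R ->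
  harmonic_sum R m * (w / 2 + 2 * c ^+ 2 / m%:R) <= (W + 4 * c ^+ 2) * (ln m%:R / m%:R).
Proof.
move=> m4 W0 wW; have m0 : 0 < m%:R :> R by rewrite ltr0n; lia.
have H2 := harmonic_sum_le2 R m4; have H0 := harmonic_sum_ge0 R m.
have -> : (W + 4 * c ^+ 2) * (ln m%:R / m%:R) =
  2 * ln m%:R * (W / m%:R / 2 + 2 * c ^+ 2 / m%:R) by field; rewrite gt_eqF.
have c2 := sqr_ge0 c.
apply: (@le_trans _ _ (harmonic_sum R m * (W / m%:R / 2 + 2 * c ^+ 2 / m%:R))).
  by rewrite ler_wpM2l // lerD2r ler_pM2r ?invr_gt0.
apply: ler_wpM2r => //.
apply: addr_ge0; first by rewrite !divr_ge0.
by rewrite divr_ge0 // mulr_ge0.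
Qed.

Lemma beta_plus_near_0 a A b B (K : R) : 0 < K -> exists (C : R) (M : nat),
  forall m sg z, (M <= m)%N -> sg = 1 \/ sg = -1 -> normc z <= K / m%:R ->
  let p := fourier_coef a A in let q := fourier_coef b B in
  let n := sg * (2 * m + 1)%N%:Z in
  exists eps : R[i], beta_plus p q n z = sigma_plus p q 0 n 0 * (1 + eps) /\
    normc eps <= C * (ln m%:R / m%:R).
Proof.
move=> K0; have [c1 a_le A_le b_le B_le] := coef_boundP a A b B.
set c := coef_bound a A b B in c1 a_le A_le b_le B_le.
have c0 : 0 <= c by lra.
have c2 : 0 <= c ^+ 2 by exact: sqr_ge0.
have k0 : 0 < K + 4 * c ^+ 2 by lra.
have [M1 HM1] := @ln_over_nat_small R ((4 * (K + 4 * c ^+ 2))^-1) ltac:(by rewrite invr_gt0 mulr_gt0).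
have [M2 HM2] := eventually_le_nat (4 * c ^+ 2).
have [M3 HM3] := eventually_le_nat K.
exists (4 * (K + 4 * c ^+ 2)), (M1 + M2 + M3 + 0 + 4)%N => m sg z.
move=> /sum_le_each[/HM1{}HM1 /HM2{}HM2 /HM3{}HM3 _ m4] sg1 zK p q n.
have m2 : (2 <= m)%N by exact: leq_trans m4.
have m0 : 0 < m%:R :> R by rewrite ltr0n (leq_trans _ m4).
have z1 : normc z <= 1 by apply: le_trans zK _; rewrite ler_pdivrMr ?mul1r.
have t_le := @total_defect_le m (normc z) K c m4 (ltW K0) zK.
have t4 : harmonic_sum R m * (normc z / 2 + 2 * c ^+ 2 / m%:R) <= 1 / 4.
  apply: le_trans t_le _.
  apply: (@le_trans _ _ ((K + 4 * c ^+ 2) * (4 * (K + 4 * c ^+ 2))^-1)).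
    by rewrite ler_wpM2l // ltW.
  by rewrite le_eqVlt; apply/orP; left; apply/eqP; field; rewrite gt_eqF.
have [eps [E eps_le]] := beta_first_order (@fourier_coef_supp a A) (@fourier_coef_supp b B)
  sg1 m2 (fun k => fourier_coef_le k c0 a_le A_le) (fun k => fourier_coef_le k c0 b_le B_le)
  HM2 z1 t4.
exists eps; split=> //; apply: le_trans eps_le _.
by rewrite -[4 * _ * _]mulrA ler_pM2l.
Qed.

Lemma eigenvalue_pair_eigenfunction (P Q : R -> R[i]) n lm lp lam :
  eigenvalue_pair P Q n lm lp -> lam = lm \/ lam = lp ->
  normc (lam - n%:~R) <= 1 / 2 /\
  exists y w, [/\ dirac_shift P Q n lam y w,
    forall x, x \in `[0, pi] -> w x = (0, 0) &
    exists2 x, x \in `[0, pi] & y x <> (0, 0)].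
Proof.
move=> [lm_n lp_n mult _] lamE.
have lam_n : `|lam - n%:~R| < 2^-1 by case: lamE => ->.
split.
  have e : 2^-1 = (2^-1)%:C :> R[i] by rewrite fmorphV rmorph_nat.
  by move: lam_n; rewrite e lt_cmod div1r => /ltW.
have := mult _ lam_n.
case: lamE => ->; rewrite eqxx; first exact: multiplicity_eigenfunction.
by rewrite addn1; exact: multiplicity_eigenfunction.
Qed.

Lemma beta_plus_eigenvalue a A b B : exists (C : R) (M : nat),
  forall m sg (lm lp lam : R[i]), (M <= m)%N -> sg = 1 \/ sg = -1 ->
  let p := fourier_coef a A in let q := fourier_coef b B in
  let n := sg * (2 * m + 1)%N%:Z in
  eigenvalue_pair (potential a A) (potential b B) n lm lp -> lam = lm \/ lam = lp ->
  exists eps : R[i],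
    beta_plus p q n (lam - n%:~R) = sigma_plus p q 0 n 0 * (1 + eps) /\
    normc eps <= C * (ln m%:R ^+ 2 / m%:R ^+ 2).
Proof.
have [c1 a_le A_le b_le B_le] := coef_boundP a A b B.
move: (coef_bound a A b B) c1 a_le A_le b_le B_le => c c1 a_le A_le b_le B_le.
have c0 : 0 <= c by lra.
have c2 : 0 <= c ^+ 2 by exact: sqr_ge0.
have [K0 [M0 M0_gt0 eig]] := resonant_eigenvalue c1.
pose C2 := `|K0| + c ^+ 2 / 4; have C20 : 0 <= C2 by rewrite addr_ge0 ?divr_ge0.
pose W := c ^+ 2 / 2 + C2; have W0 : 0 <= W by rewrite addr_ge0 ?divr_ge0.
have k0 : 0 < W + 4 * c ^+ 2 + 1 by rewrite ltr_wpDl // addr_ge0 ?mulr_ge0.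
have [M1 HM1] := @ln_over_nat_small R ((4 * (W + 4 * c ^+ 2 + 1))^-1)
  ltac:(by rewrite invr_gt0 mulr_gt0).
have [M2 HM2] := eventually_le_nat (4 * c ^+ 2).
have [M3 HM3] := eventually_le_nat M0.
have [M4 HM4] := eventually_le_nat (4 * (W / 2 + c ^+ 2)).
pose C' := C2 / 2 + c ^+ 2 / 4 + c ^+ 2 * (W / 2 + c ^+ 2).
have C'0 : 0 <= C' by rewrite !addr_ge0 ?mulr_ge0 ?addr_ge0 ?divr_ge0.
exists (4 * C' + 2 * (W + 4 * c ^+ 2) ^+ 2), (M1 + M2 + M3 + M4 + 4)%N.
move=> m sg lm lp lam /sum_le_each[/HM1{}HM1 /HM2{}HM2 /HM3{}HM3 /HM4{}HM4 m4].
move=> sg1 p q n pair lamE.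
have m2 : (2 <= m)%N by exact: leq_trans m4.
have m_gt0 : (0 < m)%N by exact: leq_trans m4.
have m0 : 0 < m%:R :> R by rewrite ltr0n.
have m20 : 0 < m%:R ^+ 2 :> R by rewrite exprn_gt0.
have L1 := ln_nat_ge1 R m4.
have [z_half [y [w [yw w0 y0]]]] := eigenvalue_pair_eigenfunction pair lamE.
have n_abs : `|n|%N = (2 * m + 1)%N by rewrite /n; clear -sg1; case: sg1 => ->; lia.
have n_ge : m%:R <= `|n|%N%:R :> R by rewrite ler_nat n_abs; clear; lia.
have := eig _ _ _ _ _ _ _ _ a_le A_le b_le B_le (le_trans HM3 n_ge) z_half yw w0 y0.
set z := lam - n%:~R in z_half *; set k := a * B + A * b => z_k.
have {z_k} z_k : normc (z - k / (2 * n%:~R)) <= `|K0| / m%:R ^+ 2.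
  apply: le_trans z_k _; apply: (@le_trans _ _ (`|K0| / `|n|%N%:R ^+ 2)).
    by rewrite ler_wpM2r ?invr_ge0 ?exprn_ge0 // ler_norm.
  rewrite ler_wpM2l // lef_pV2 ?posrE ?exprn_gt0 //; last exact: lt_le_trans n_ge.
  by rewrite ler_pXn2r ?nnegrE.
have k_le : normc k <= 2 * c ^+ 2.
  apply: le_trans (ler_normcD _ _) _; rewrite mulr2n mulrDl !mul1r expr2.
  by apply: lerD; exact: mul_le.
have mC : m%:R != 0 :> R[i] by rewrite pnatr_eq0 -lt0n.
have m1C : 2 * m%:R + 1 != 0 :> R[i] by rewrite -natrM -(natrD _ _ 1) pnatr_eq0 addn1.
have zeta_k : normc (sg%:~R * z - k / (4 * m%:R)) <= C2 / m%:R ^+ 2.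
  have -> : sg%:~R * z - k / (4 * m%:R) =
      sg%:~R * (z - k / (2 * n%:~R)) - k / (4 * (m%:R * (2 * m%:R + 1))).
    have nE : n%:~R = sg%:~R * (2 * m%:R + 1) :> R[i].
      by rewrite /n rmorphM /= -[(_%:Z)%:~R]/((2 * m + 1)%N%:R) natrD natrM.
    have s0 : sg%:~R != 0 :> R[i] by rewrite -normc_gt0 (normc_sign R sg1).
    rewrite nE; move: (sg%:~R : R[i]) s0 => s s0.
    by field; rewrite mC m1C s0.
  apply: le_trans (ler_normcB _ _) _; rewrite (normc_mul sg%:~R) (normc_sign R sg1) mul1r.
  rewrite /C2 [leRHS]mulrDl; apply: lerD => //.
  rewrite normc_mul normc_inv.
  have -> : c ^+ 2 / 4 / m%:R ^+ 2 = 2 * c ^+ 2 * (8 * m%:R ^+ 2)^-1 by field; rewrite gt_eqF.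
  apply: ler_pM; rewrite ?invr_ge0 ?normc_ge0 //.
  have -> : 4 * (m%:R * (2 * m%:R + 1)) = (4 * (m * (2 * m + 1)))%N%:R :> R[i].
    by rewrite !natrM natrD natrM.
  rewrite normc_nat -natrX -natrM lef_pV2 ?posrE ?ltr0n ?ler_nat; [clear; nia|clear -m_gt0; nia|].
  by rewrite muln_gt0 expn_gt0 m_gt0.
have z_le : normc z <= W / m%:R.
  have -> : normc z = normc (sg%:~R * z) by rewrite (normc_mul sg%:~R) (normc_sign R sg1) mul1r.
  have -> : sg%:~R * z = k / (4 * m%:R) + (sg%:~R * z - k / (4 * m%:R)) by ring.
  apply: le_trans (ler_normcD _ _) _; rewrite /W [leRHS]mulrDl; apply: lerD.
    rewrite normc_mul normc_inv normc_mul !normc_nat.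
    have -> : c ^+ 2 / 2 / m%:R = 2 * c ^+ 2 / (4 * m%:R) by field; rewrite gt_eqF.
    by rewrite ler_wpM2r // invr_ge0 mulr_ge0 // ltW.
  apply: le_trans zeta_k _; rewrite ler_wpM2l // lef_pV2 ?posrE // expr2 ler_peMl ?(ltW m0) //.
  by rewrite ler1n.
have z1 : normc z <= 1 by lra.
have t_le := @total_defect_le m (normc z) W c m4 W0 z_le.
have Lm : 0 <= ln m%:R / m%:R :> R by rewrite divr_ge0 // ?ltW //; lra.
have t4 : harmonic_sum R m * (normc z / 2 + 2 * c ^+ 2 / m%:R) <= 1 / 4.
  apply: le_trans t_le _.
  apply: (@le_trans _ _ ((W + 4 * c ^+ 2 + 1) * (4 * (W + 4 * c ^+ 2 + 1))^-1)).
    by apply: ler_pM => //; [rewrite addr_ge0 ?mulr_ge0 | rewrite lerDl].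
  by rewrite le_eqVlt; apply/orP; left; apply/eqP; field; rewrite gt_eqF.
have rho4 : normc z / 2 + c ^+ 2 / m%:R <= 1 / 4.
  apply: (@le_trans _ _ ((W / 2 + c ^+ 2) / m%:R)).
    by rewrite mulrDl lerD2r mulrAC ler_pM2r ?invr_gt0.
  rewrite ler_pdivrMr //; lra.
have kE : q (- (2 * sg)) * p (2 * sg) + p (- (2 * sg)) * q (2 * sg) = k.
  by rewrite /p /q /k /fourier_coef; case: sg1 => -> /=; ring.
rewrite -kE in zeta_k.
have [eps [E eps_le]] := beta_second_order (@fourier_coef_supp a A) (@fourier_coef_supp b B)
  sg1 m2 (fun k => fourier_coef_le k c0 a_le A_le) (fun k => fourier_coef_le k c0 b_le B_le)
  HM2 z1 zeta_k z_le rho4 t4.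
exists eps; split=> //; apply: le_trans eps_le _; rewrite -/C'.
have H2 := harmonic_sum_le2 R m4; have H0 := harmonic_sum_ge0 R m.
have -> : (4 * C' + 2 * (W + 4 * c ^+ 2) ^+ 2) * (ln m%:R ^+ 2 / m%:R ^+ 2) =
  2 * (2 * ln m%:R ^+ 2 / m%:R ^+ 2 * C' + ((W + 4 * c ^+ 2) * (ln m%:R / m%:R)) ^+ 2).
  by field; rewrite gt_eqF.
rewrite ler_pM2l //; apply: lerD.
  apply: ler_wpM2r => //; apply: ler_wpM2r; first by rewrite invr_ge0 ltW.
  apply: le_trans H2 _; rewrite ler_pM2l // expr2 ler_peMl //; lra.
have t0 : 0 <= harmonic_sum R m * (normc z / 2 + 2 * c ^+ 2 / m%:R).
  by rewrite mulr_ge0 // addr_ge0 // divr_ge0 ?normc_ge0 ?mulr_ge0.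
by rewrite ler_pXn2r ?nnegrE //; exact: le_trans t_le.
Qed.

End Assembly.

Theorem proposition15 (R : realType) (a A b B : R[i])
    (ha : a != 0) (hA : A != 0) (hb : b != 0) (hB : B != 0) :
  let P := potential a A in
  let Q := potential b B in
  let p := fourier_coef a A in
  let q := fourier_coef b B in
  [/\ forall K : R, 0 < K -> exists (C : R) (M : nat),
        forall (m : nat) (n : int) (z : R[i]), (M <= m)%N ->
          n = (2 * m + 1)%N%:Z \/ n = - (2 * m + 1)%N%:Z ->
          `|z| <= (K / m%:R)%:C ->
          exists eps : R[i],
            beta_plus p q n z = sigma_plus p q 0 n 0 * (1 + eps) /\
            `|eps| <= (C * (ln m%:R / m%:R))%:C,
      exists (C : R) (M : nat),
        forall (m : nat) (n : int) (lm lp : R[i]), (M <= m)%N ->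
          n = (2 * m + 1)%N%:Z \/ n = - (2 * m + 1)%N%:Z ->
          eigenvalue_pair P Q n lm lp ->
          forall lam : R[i], lam = lm \/ lam = lp ->
          exists eps : R[i],
            beta_plus p q n (lam - n%:~R) = sigma_plus p q 0 n 0 * (1 + eps) /\
            `|eps| <= (C * (ln m%:R ^+ 2 / m%:R ^+ 2))%:C &
      forall m : nat,
        sigma_plus p q 0 (2 * m + 1)%N%:Z 0 =
          A ^+ m * B ^+ m.+1 / (4 ^+ (2 * m) * (m`!%:R) ^+ 2) /\
        sigma_plus p q 0 (- (2 * m + 1)%N%:Z) 0 =
          a ^+ m * b ^+ m.+1 / (4 ^+ (2 * m) * (m`!%:R) ^+ 2)].
Proof.
move=> P Q p q.
have signed (m : nat) n : n = (2 * m + 1)%N%:Z \/ n = - (2 * m + 1)%N%:Z ->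
    exists2 sg : int, sg = 1 \/ sg = -1 & n = sg * (2 * m + 1)%N%:Z.
  by case=> ->; [exists 1; [left|rewrite mul1r] | exists (-1); [right|rewrite mulN1r]].
split.
- move=> K K0; have [C [M H]] := beta_plus_near_0 a A b B K0.
  exists C, M => m n z Mm /signed[sg sg1 ->]; rewrite le_cmod => zK.
  have [eps [E eps_le]] := H m sg z Mm sg1 zK.
  by exists eps; rewrite le_cmod.
- have [C [M H]] := beta_plus_eigenvalue a A b B.
  exists C, M => m n lm lp Mm /signed[sg sg1 ->] pair lam lamE.
  have [eps [E eps_le]] := H m sg lm lp lam Mm sg1 pair lamE.
  by exists eps; rewrite le_cmod.
move=> m; split.
  have := sigma_plus0_fourier a A b B m (or_introl (erefl (1 : int))).
  by rewrite mul1r => ->.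
have := sigma_plus0_fourier a A b B m (or_intror (erefl (-1 : int))).
by rewrite mulN1r => ->.
Qed.
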